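(* Let $A$ be an algebra and $L:A\to\mathbb{R}$ linear with $L(1)=1$. (i) There exists an $X(A)$-representing measure $\mu$ for $L$ on the cylinder $\sigma$-algebra $\Sigma_I$ if and only if for every $S\in I$ there exists an $X(S)$-representing Radon measure $\mu_S$ for $L|_S$ such that $\{\mu_S:S\in I\}$ is an exact projective system and the corresponding exact projective system $\{\mu_T:T\in\Lambda\}$ is thick. (ii) There exists an $X(A)$-representing Radon measure $\nu$ for $L$ if and only if for every $S\in I$ there exists an $X(S)$-representing Radon measure $\mu_S$ for $L|_S$ such that $\{\mu_S:S\in I\}$ fulfills Prokhorov's condition.
   Context: All algebras are unital commutative real algebras, subalgebras contain the unit, and $X(A)\neq\emptyset$. For an algebra $S$, $X(S)$ is the set of unital $\mathbb{R}$-algebra homomorphisms $S\to\mathbb{R}$ (characters), with the weakest topology $\tau_{X(S)}$ such that for all $a\in S$ the function $\hat a:X(S)\to\mathbb{R}$, $\hat a(\alpha)=\alpha(a)$, is continuous; $\mathcal{B}_{X(S)}$ is its Borel $\sigma$-algebra. For subalgebras $S\subseteq T$ of $A$, $\pi_{S,T}:X(T)\to X(S)$ is the restriction map and $\pi_S:=\pi_{S,A}$. $I$ is the set of all finitely generated subalgebras of $A$ and $\Lambda$ the set of all countably generated subalgebras of $A$, both ordered by inclusion. The cylinder $\sigma$-algebra $\Sigma_I$ is the smallest $\sigma$-algebra on $X(A)$ such that all $\pi_S:X(A)\to (X(S),\mathcal{B}_{X(S)})$, $S\in I$, are measurable. Representing measures: for an algebra $B$, $\ell:B\to\mathbb{R}$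 linear, a $\sigma$-algebra $\Sigma$ on $X(B)$ and $K\in\Sigma$, a $K$-representing measure for $\ell$ on $\Sigma$ is a measure $\nu$ on $\Sigma$ supported in $K$, i.e. $\nu(X(B)\setminus K)=0$, with $\ell(a)=\int_{X(B)}\alpha(a)\,d\nu(\alpha)$ for all $a\in B$. A Radon measure on a Hausdorff space is a Borel measure that is locally finite and inner regular with respect to compact sets (on all Borel sets). A $K$-representing Radon measure is a $K$-representing measure on $\mathcal{B}_{X(B)}$ that is Radon. Exact systems: a family $\{\mu_S:S\in I\}$ of measures $\mu_S$ on $\mathcal{B}_{X(S)}$ is an exact projective system if $(\pi_{S,T})_\#\mu_T=\mu_S$ (pushforward) for all $S\subseteq T$ in $I$; similarly for $\Lambda$. If $\{\mu_S:S\in I\}$ is an exact projective system of Radon probability measures, then for every $T\in\Lambda$ there is a unique Radon probability measure $\mu_T$ on $\mathcal{B}_{X(T)}$ with $(\pi_{S,T})_\#\mu_T=\mu_S$ for all $S\in I$ with $S\subseteq T$, and $\{\mu_T:T\in\Lambda\}$ is an exact projective system, called the corresponding one. It is called thick if for every $T\in\Lambda$, $\mu_T(M)=0$ for all $M\in\mathcal{B}_{X(T)}$ with $\pi_T(X(A))\cap M=\emptyset$. Prokhorov's condition for a family $\{\mu_S:S\in I\}$ of Radon probability measures on the $X(S)$: for every $\varepsilon>0$ there is a compact $C_\varepsilon\subset X(A)$ such that $\mu_S(\pi_S(C_\varepsilon))\ge 1-\varepsilon$ for all $S\in I$. *)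

(* Defs.v *)
From HB Require Import structures.
From mathcomp Require Import all_boot all_order all_algebra.
From mathcomp Require Import all_classical all_reals all_analysis.

Set Implicit Arguments.
Unset Strict Implicit.
Unset Printing Implicit Defensive.

Import Order.TTheory GRing.Theory Num.Theory.
Import numFieldNormedType.Exports.

Local Open Scope classical_set_scope.
Local Open Scope ring_scope.

HB.mixin Record HasCharacter (R : realType) B of GRing.ComAlgebra R B := {
  has_character : inhabited {lrmorphism B -> R | *%R}
}.

(* Unital commutative real algebras B with X(B) nonempty.  Nonemptiness is
   needed to speak of X(B) at all in MathComp-Analysis, where every measurable
   space is pointed. *)
#[short(type="charAlgType")]
HB.structure Definition CharAlgebra (R : realType) :=
  {B of GRing.ComAlgebra R B & HasCharacter R B}.

Section CharacterSpace.
Context {R : realType}.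

Definition X (B : charAlgType R) : Type := {lrmorphism B -> R | *%R}.

Definition hat (B : charAlgType R) (a : B) (alpha : X B) : R :=
  (alpha : {lrmorphism B -> R | *%R}) a.

HB.instance Definition _ (B : charAlgType R) := gen_eqMixin (X B).
HB.instance Definition _ (B : charAlgType R) := gen_choiceMixin (X B).

Fact X_inhabited (B : charAlgType R) : exists alpha : X B, True.
Proof. by case: (@has_character R B) => alpha; exists alpha. Qed.

HB.instance Definition _ (B : charAlgType R) :=
  isPointed.Build (X B) (projT1 (cid (X_inhabited B))).

(* The weakest topology making every [hat a] continuous. *)
HB.instance Definition _ (B : charAlgType R) := Topological.copy (X B)
  (sup_topology (fun a : B => Topological.class (initial_topology (hat a)))).

End CharacterSpace.

(* A measure on the sigma-algebra generated by G is an element of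
   [{measure set (g_sigma_algebraType G) -> \bar R}]; it is only meaningful on
   that sigma-algebra, so equalities of measures below are restricted to it. *)
Definition borel (T : ptopologicalType) := g_sigma_algebraType (@open T).

Section Radon.
Local Open Scope ereal_scope.
Context {R : realType} {T : ptopologicalType}.
Implicit Type mu : {measure set (borel T) -> \bar R}.

Definition locally_finite mu :=
  forall x : T, exists2 U : set T, open_nbhs x U & mu U < +oo.

(* For Hausdorff T (such as X(B), see [X_hausdorff]), where compact sets are
   Borel. *)
Definition compact_inner_regular mu :=
  forall M : set (borel T), measurable M ->
    mu M = ereal_sup [set mu C | C in [set C : set T | compact C /\ C `<=` M]].

Definition radon mu := locally_finite mu /\ compact_inner_regular mu.

Definition radon_probability mu := radon mu /\ mu setT = 1.

End Radon.

Lemma continuous_hat (R : realType) (B : charAlgType R) (a : B) :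
  continuous (hat a : X B -> R).
Proof.
move=> x; have /cvg_sup/(_ a) h : nbhs x --> (x : X B) by [].
move=> V /= nV; apply: h.
exact: (@initial_continuous (X B) R (hat a) x V nV).
Qed.

Lemma eq_character (R : realType) (B : charAlgType R) (x y : X B) :
  (forall a, hat a x = hat a y) -> x = y.
Proof.
case: x y => f cf [g cg] fg.
have {}fg : f = g by apply/funext => a; exact: (fg a).
case: g / fg cg => cg; congr GRing.LRMorphism.Pack.
case: cf cg => [[a] [b] [c]] [[a'] [b'] [c']].
rewrite (Prop_irrelevance a a') (Prop_irrelevance b b').
by rewrite (Prop_irrelevance c c').
Qed.

Lemma X_hausdorff (R : realType) (B : charAlgType R) : hausdorff_space (X B).
Proof.
move=> x y cxy; apply: eq_character => a; apply: (@Rhausdorff R) => U V nU nV.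
have [z [Uz Vz]] := cxy _ _ (continuous_hat nU) (continuous_hat nV).
by exists (hat a z).
Qed.

Section Representing.
Local Open Scope ereal_scope.
Context {R : realType} {B : charAlgType R}.

(* Integrability is stated separately because the integral of MathComp-Analysis
   is a total operation. *)
Definition representing (l : {scalar B}) (K : set (X B)) (G : set (set (X B)))
    (nu : {measure set (g_sigma_algebraType G) -> \bar R}) :=
  [/\ <<s G >> K,
      nu (~` K) = 0,
      (forall a : B, nu.-integrable setT (fun alpha => (hat a alpha)%:E)) &
      (forall a : B, \int[nu]_alpha (hat a alpha)%:E = (l a)%:E)].

Definition radon_representing (l : {scalar B}) (K : set (X B))
    (nu : {measure set (borel (X B)) -> \bar R}) :=
  representing l K nu /\ radon nu.

End Representing.

Section Subalgebras.
Context {R : realType} {A : charAlgType R}.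

(* Subalgebras of A are the subsets of A of type [subalgClosed A]; [carrier S]
   is S regarded as an algebra. *)
Definition carrier (S : subalgClosed A) : Type := {a : A | a \in S}.

HB.instance Definition _ (S : subalgClosed A) := SubChoice.on (carrier S).
HB.instance Definition _ (S : subalgClosed A) :=
  [SubChoice_isSubAlgebra of carrier S by <:].
HB.instance Definition _ (S : subalgClosed A) :=
  [SubNzRing_isSubComNzRing of carrier S by <:].

Section Inclusion.
Variable S : subalgClosed A.

Definition inclA_fun (a : carrier S) : A := \val a.

Fact inclA_is_linear : linear inclA_fun.
Proof. exact: (linearP (\val : {linear carrier S -> A})). Qed.

Fact inclA_is_monoid_morphism : monoid_morphism inclA_fun.
Proof. exact: GRing.valM1. Qed.

HB.instance Definition _ :=
  GRing.isLinear.Build R (carrier S) A _ inclA_fun inclA_is_linear.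
HB.instance Definition _ :=
  GRing.isMonoidMorphism.Build (carrier S) A inclA_fun inclA_is_monoid_morphism.

Definition inclA : {lrmorphism carrier S -> A} := inclA_fun.

End Inclusion.

Fact carrier_has_character (S : subalgClosed A) :
  inhabited {lrmorphism carrier S -> R | *%R}.
Proof.
case: (@has_character R A) => alpha; split.
exact: (alpha \o inclA S : {lrmorphism _ -> _ | *%R}).
Qed.

HB.instance Definition _ (S : subalgClosed A) :=
  HasCharacter.Build R (carrier S) (carrier_has_character S).

Section Inclusion2.
Variables (S T : subalgClosed A) (ST : {subset S <= T}).

Definition inclS_fun (a : carrier S) : carrier T :=
  Sub (inclA S a) (ST (valP a)).

Fact inclS_is_linear : linear inclS_fun.
Proof. by move=> c a b; apply: val_inj; rewrite !(SubK, linearP). Qed.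

Fact inclS_is_monoid_morphism : monoid_morphism inclS_fun.
Proof. by split=> [|a b]; apply: val_inj; rewrite /= ?(rmorph1, rmorphM). Qed.

HB.instance Definition _ :=
  GRing.isLinear.Build R (carrier S) (carrier T) _ inclS_fun inclS_is_linear.
HB.instance Definition _ :=
  GRing.isMonoidMorphism.Build (carrier S) (carrier T) inclS_fun
    inclS_is_monoid_morphism.

Definition inclS : {lrmorphism carrier S -> carrier T} := inclS_fun.

End Inclusion2.

Definition restr (B C : charAlgType R) (f : {lrmorphism B -> C})
    (alpha : X C) : X B :=
  ((alpha : {lrmorphism C -> R | *%R}) \o f : {lrmorphism B -> R | *%R}).

Definition restrA (S : subalgClosed A) : X A -> X (carrier S) := restr (inclA S).

Definition restrS (S T : subalgClosed A) (ST : {subset S <= T}) :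
  X (carrier T) -> X (carrier S) := restr (inclS ST).

Definition generated_by (F : set A) (S : subalgClosed A) :=
  F `<=` [set` S] /\
  forall T : subalgClosed A, F `<=` [set` T] -> {subset S <= T}.

Definition fin_gen : set (subalgClosed A) :=
  [set S | exists2 F : set A, finite_set F & generated_by F S].

Definition countably_gen : set (subalgClosed A) :=
  [set S | exists2 F : set A, countable F & generated_by F S].

(* Generators of the cylinder sigma-algebra. *)
Definition cylinder : set (set (X A)) :=
  \bigcup_(S in fin_gen)
    preimage_set_system setT (restrA S : _ -> borel (X (carrier S))) measurable.

Local Open Scope ereal_scope.

(* A family indexed by a set J of subalgebras (below, [fin_gen] or
   [countably_gen]) is encoded as one indexed by all subalgebras, whose values
   outside J are irrelevant. *)
Definition measure_family : Type :=
  forall S : subalgClosed A, {measure set (borel (X (carrier S))) -> \bar R}.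

Definition exact_system (J : set (subalgClosed A)) (mu : measure_family) :=
  forall (S T : subalgClosed A) (ST : {subset S <= T}), J S -> J T ->
    forall M, measurable M ->
      pushforward (mu T) (restrS ST : borel _ -> borel _) M = mu S M.

(* [muL] is the system on the countably generated subalgebras corresponding to
   the system [mu] on the finitely generated ones. It is determined by [mu]
   (on Borel sets), and exact. *)
Definition corresponding (mu muL : measure_family) :=
  forall T, countably_gen T ->
    radon_probability (muL T) /\
    forall (S : subalgClosed A) (ST : {subset S <= T}), fin_gen S ->
      forall M, measurable M ->
        pushforward (muL T) (restrS ST : borel _ -> borel _) M = mu S M.

Definition thick (muL : measure_family) :=
  forall T, countably_gen T ->
    forall M : set (borel (X (carrier T))), measurable M ->
      range (restrA T) `&` M = set0 -> muL T M = 0.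

Definition prokhorov (mu : measure_family) :=
  forall e : R, (0 < e)%R ->
    exists2 C : set (X A), compact C &
      forall S, fin_gen S -> (1 - e)%:E <= mu S (restrA S @` C).

End Subalgebras.

Arguments restrA {R A} S.
Arguments measure_family {R} A.
Arguments cylinder {R} A.

(* Main.v *)
Require Import Defs.
From HB Require Import structures.
From mathcomp Require Import all_boot all_order all_algebra.
From mathcomp Require Import all_classical all_reals all_analysis.
From mathcomp Require Import measurable_realfun lra.

Set Implicit Arguments.
Unset Strict Implicit.
Unset Printing Implicit Defensive.

Import Order.TTheory GRing.Theory Num.Theory.
Import numFieldNormedType.Exports.

Local Open Scope classical_set_scope.
Local Open Scope ring_scope.

(** When [T] is countably generated, the Borel sets of X(T) are generated by the
    functions [hat a], and bounding a sequence of generators cuts out a compact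
    subset of X(T); hence every finite Borel measure on X(T) is Radon.  This
    makes all push-forwards to X(T) Radon, and, since the cylinder
    sigma-algebra consists of the sets [restrA T @^-1` M] with [T] in Lambda and
    [M] Borel, thickness is what makes [restrA T @^-1` M |-> muL T M]
    well-defined and sigma-additive.

    For the converse of (ii) the family need not be exact.  Along an ultrafilter
    on I, [K |-> lim (mu T (restrA T @` K))] is a content on the compact subsets
    of X(A): disjoint compact sets have disjoint images in X(T) for [T] large
    enough.  By Prokhorov's condition the content is tight, and it extends to a
    Radon probability measure [nu] as in Halmos' construction.  Superlevel sets
    of [hat (a * a)] are open, so [nu] is lower semicontinuous on them and
    [\int (hat (a * a)) <= L (a * a)]; applied to [a + t] for all real [t], this
    forces [\int (hat a) = L a]. *)

(** * Character spaces and generated subalgebras *)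

Lemma measurable_open (T : ptopologicalType) (V : set T) :
  open V -> measurable (V : set (borel T)).
Proof. by move=> oO; apply: sub_sigma_algebra. Qed.

Lemma measurable_closed (T : ptopologicalType) (V : set T) :
  closed V -> measurable (V : set (borel T)).
Proof.
move=> cO; rewrite -[V]setCK; apply: measurableC; apply: measurable_open.
exact: closed_openC.
Qed.

Lemma continuous_measurable_borel (S T : ptopologicalType) (f : S -> T) :
  continuous f -> measurable_fun setT (f : borel S -> borel T).
Proof.
move=> cf; apply: (@measurability _ _ (borel S) (borel T) setT f (@open T)) => //.
move=> _ [V oV <-].
by rewrite setTI; apply: measurable_open; move/continuousP : cf; exact.
Qed.

Section CharacterTopology.
Context {R : realType} {B : charAlgType R}.

(** The topology is the supremum of the initial topologies of the [hat a], so convergence of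
    characters can be tested on one [a] at a time. *)
Lemma cvg_hatP (F : set_system (X B)) (x : X B) : Filter F ->
  (forall a, hat a @ F --> hat a x) -> F --> x.
Proof.
move=> FF cF; apply/(@cvg_sup (X B) B
  (fun a : B => Topological.class (initial_topology (hat a)))) => a V nV.
move: nV; rewrite nbhsE => - [W [[V0 oV0 <-] V0x] WV].
have /cF : nbhs (hat a x) V0 by apply: open_nbhs_nbhs.
by move=> FV; apply: (filterS WV); exact: FV.
Qed.

Lemma hat1 (x : X B) : hat 1 x = 1.
Proof. exact: rmorph1. Qed.

Lemma hatD (a b : B) (x : X B) : hat (a + b) x = hat a x + hat b x.
Proof. exact: raddfD. Qed.

Lemma hatM (a b : B) (x : X B) : hat (a * b) x = hat a x * hat b x.
Proof. exact: rmorphM. Qed.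

Lemma hatZ c (a : B) (x : X B) : hat (c *: a) x = c * hat a x.
Proof. exact: linearZ. Qed.

Lemma measurable_hat (a : B) :
  measurable_fun setT (hat a : borel (X B) -> R).
Proof.
apply: (measurability _ (RGenOInfty.measurableE R)) => _ [_ [r ->] <-].
rewrite setTI; apply: measurable_open.
by move/continuousP : (@continuous_hat R B a); apply; exact: interval_open.
Qed.

Lemma open_hat_gt (a : B) (r : R) : open [set x : X B | r < hat a x].
Proof.
rewrite (_ : [set x | _] = hat a @^-1` `]r, +oo[%classic).
  by move/continuousP : (@continuous_hat R B a); apply; exact: interval_open.
by apply/seteqP; split=> x /=; rewrite in_itv/= andbT.
Qed.

End CharacterTopology.

Lemma continuous_restr (R : realType) (B C : charAlgType R)
  (f : {lrmorphism B -> C}) : continuous (restr f : X C -> X B).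
Proof.
move=> x; have FF : Filter (restr f @ x).
  by have := @fmap_filter _ _ (restr f) _ (@nbhs_filter (X C) x).
apply: cvg_hatP => a.
exact: (@continuous_hat R C (f a) x).
Qed.

Section GeneratedSubalgebra.
Context {R : realType} {A : charAlgType R}.

Section Gen.
Variable F : set A.

Definition gen_pred (a : A) : bool :=
  `[< forall T : subalgClosed A, F `<=` [set` T] -> a \in T >].

Fact gen_pred_closed : GRing.subalg_closed gen_pred.
Proof.
split=> [|c a b /asboolP ha /asboolP hb|a b /asboolP ha /asboolP hb];
  apply/asboolP => T FT.
- exact: rpred1.
- by apply: rpredD; [apply: rpredZ; exact: ha|exact: hb].
- by apply: rpredM; [exact: ha|exact: hb].
Qed.

Definition gen : subalgClosed A :=
  HB.pack gen_pred (GRing.isSubalgClosed.Build R A gen_pred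
    (GRing.subalg_closed_semi gen_pred_closed)).

Lemma gen_generated : generated_by F gen.
Proof.
split=> [a Fa|T FT a /asboolP]; last exact.
by apply/asboolP => T; exact.
Qed.

End Gen.
End GeneratedSubalgebra.

(* The algebra generated by [f] is [B], stated as an induction principle. *)
Definition generates (R : realType) (B : charAlgType R) (f : nat -> B) :=
  forall P : set B, P 1 -> (forall c a b, P a -> P b -> P (c *: a + b)) ->
    (forall a b, P a -> P b -> P (a * b)) -> (forall n, P (f n)) ->
  forall a, P a.

Section CountableGeneration.
Context {R : realType} {A : charAlgType R}.
Implicit Types S T : subalgClosed A.

(** The elements satisfying [P], viewed inside [A], form a subalgebra [Q] containing [F]; minimality
    of [T] among such subalgebras puts all of [T] in it. *)
Lemma generated_by_ind (F : set A) T (P : set (carrier T)) :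
  generated_by F T -> P 1 -> (forall c a b, P a -> P b -> P (c *: a + b)) ->
  (forall a b, P a -> P b -> P (a * b)) -> (forall a, F (\val a) -> P a) ->
  forall a, P a.
Proof.
move=> [FT minT] P1 Plin Pmul PF a.
pose Q (x : A) : bool := `[< exists2 y : carrier T, P y & \val y = x >].
have Qclosed : GRing.subalg_closed Q.
  split=> [|c _ _ /asboolP[x Px <-] /asboolP[y Py <-]|
             _ _ /asboolP[x Px <-] /asboolP[y Py <-]]; apply/asboolP.
  - by exists 1.
  - exists (c *: x + y); first exact: Plin.
    by rewrite (linearP (\val : {linear carrier T -> A})).
  - exists (x * y); first exact: Pmul.
    by rewrite (rmorphM (\val : {rmorphism carrier T -> A})).
pose V : subalgClosed A := HB.pack Q (GRing.isSubalgClosed.Build R A Q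
    (GRing.subalg_closed_semi Qclosed)).
have /(minT V)/(_ _ (valP a))/asboolP[y Py /val_inj <- //] : F `<=` [set` V].
move=> x Fx; apply/asboolP; exists (Sub x (FT x Fx)); last exact: SubK.
by apply: PF; rewrite SubK.
Qed.

Lemma countably_gen_generates T : countably_gen T ->
  exists f : nat -> carrier T, generates f.
Proof.
move=> [F /pfcard_geP[F0|[g]] FT].
  (* Without generators only scalars remain, and the constant sequence [1] generates them. *)
  exists (fun=> 1) => P P1 Plin Pmul _; apply: (generated_by_ind FT) => // a.
  by rewrite F0.
have gT n : g n \in T by apply: FT.1; exact: funS.
exists (fun n => Sub (g n) (gT n)) => P P1 Plin Pmul Pg.
apply: (generated_by_ind FT) => // a /(@surj _ _ _ _ g)[n _ gn].
suff -> : a = Sub (g n) (gT n) by exact: Pg.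
by apply: val_inj; rewrite SubK.
Qed.

Lemma fin_gen_countably_gen : @fin_gen R A `<=` countably_gen.
Proof. by move=> S [F /finite_set_countable cF FS]; exists F. Qed.

Lemma gen_countably_gen (F : set A) : countable F -> countably_gen (gen F).
Proof. by move=> cF; exists F => //; exact: gen_generated. Qed.

Lemma gen_fin_gen (F : set A) : finite_set F -> fin_gen (gen F).
Proof. by move=> cF; exists F => //; exact: gen_generated. Qed.

Lemma sub_gen (F : set A) : F `<=` [set` gen F].
Proof. exact: (gen_generated F).1. Qed.

Lemma gen_sub (F : set A) T : F `<=` [set` T] -> {subset gen F <= T}.
Proof. exact: (gen_generated F).2. Qed.

Lemma countably_gen_bigcup (T : nat -> subalgClosed A) :
  (forall n, countably_gen (T n)) ->
  exists2 S, countably_gen S & forall n, {subset T n <= S}.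
Proof.
move=> cT; have /choice[F] : forall n, exists F, countable F /\ generated_by F (T n).
  by move=> n; have [F cF FT] := cT n; exists F.
move=> /all_and2[cF FT]; exists (gen (\bigcup_n F n)).
  by apply: gen_countably_gen; apply: bigcup_countable => //.
by move=> n; apply: (FT n).2 => a Fa; apply: sub_gen; exists n.
Qed.

(** The final clause, minimality of [V], keeps [V] inside any subalgebra containing both [S] and
    [T]; intersecting two cylinder sets over such a subalgebra relies on it. *)
Lemma fin_gen_setU S T : fin_gen S -> fin_gen T ->
  exists V, [/\ fin_gen V, {subset S <= V}, {subset T <= V} &
    forall W : subalgClosed A, {subset S <= W} -> {subset T <= W} -> {subset V <= W}].
Proof.
move=> [F fF FS] [G fG GT]; exists (gen (F `|` G)); split.
- by apply: gen_fin_gen; rewrite finite_setU.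
- by apply: FS.2 => a Fa; apply: sub_gen; left.
- by apply: GT.2 => a Ga; apply: sub_gen; right.
- by move=> W SW TW; apply: gen_sub => a [/FS.1/SW|/GT.1/TW].
Qed.

End CountableGeneration.

Lemma dist_lt_itvoo (R : realType) (w z r : R) :
  w < z -> z < w + r -> `|z - w| < r.
Proof. by move=> wz zr; rewrite ltr_norml; apply/andP; split; lra. Qed.

(** * Countable bases of countably generated character spaces *)

Section CountablyGenerated.
Context {R : realType} {B : charAlgType R}.
Variable f : nat -> B.
Hypothesis genf : generates f.

(** The centre is a finite sequence, so that the boxes with rational centres can be indexed by the
    countable type [nat * seq rat]. *)
Definition box n (q : seq R) (e : R) : set (X B) :=
  [set y | forall i, (i < n)%N -> `|q`_i - hat (f i) y| < e].

(** The elements [a] for which [hat a] converges along [F] are closed under the algebra operations,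
    so convergence on generators suffices. *)
Lemma cvg_hat_generates (F : set_system (X B)) (x : X B) : ProperFilter F ->
  (forall n, hat (f n) @ F --> hat (f n) x) -> F --> x.
Proof.
move=> FF cf; apply: cvg_hatP; apply: genf => //.
- have -> : hat 1 = cst 1 :> (X B -> R) by apply/funext => y; exact: hat1.
  exact: cvg_cst.
- move=> c a b ca cb.
  have -> : hat (c *: a + b) = fun y : X B => c * hat a y + hat b y.
    by apply/funext => y; rewrite hatD hatZ.
  by apply: cvgD => //; apply: cvgMr.
- move=> a b ca cb.
  have -> : hat (a * b) = fun y : X B => hat a y * hat b y.
    by apply/funext => y; rewrite hatM.
  exact: cvgM.
Qed.

(** The boxes around [x], with more coordinates and smaller radii as [n] grows, are the base of a
    filter; it converges to [x] because it does so on every generator. *)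
Lemma nbhs_box (x : X B) (U : set (X B)) : nbhs x U ->
  exists n, box n [seq hat (f i) x | i <- iota 0 n] n.+1%:R^-1 `<=` U.
Proof.
pose D n := box n [seq hat (f i) x | i <- iota 0 n] n.+1%:R^-1.
have DE n y : D n y <-> forall i, (i < n)%N -> `|hat (f i) x - hat (f i) y| < n.+1%:R^-1.
  by split=> h i ni; have := h i ni; rewrite (nth_map 0%N) ?size_iota// nth_iota.
have Dle m n : (m <= n)%N -> D n `<=` D m.
  move=> mn y /DE h; apply/DE => i im; apply: (lt_le_trans (h i (leq_trans im mn))).
  by rewrite lef_pV2 ?posrE// ler_nat.
have Dx n : D n x by apply/DE => i _; rewrite subrr normr0 invr_gt0.
have FF : ProperFilter (filter_from setT D).
  apply: filter_from_proper => [|n _]; last by exists x.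
  apply: filter_from_filter; first by exists 0%N.
  move=> m n _ _; exists (maxn m n) => // y Dy.
  by split; apply: Dle Dy; rewrite ?leq_maxl ?leq_maxr.
suff : filter_from setT D --> x by move=> h /h[n _ DU]; exists n.
apply: cvg_hat_generates => n; apply/cvgrPdist_lt => e e0.
have [m em] : exists m, m.+1%:R^-1 < e.
  exists (Num.truncn e^-1); rewrite invf_plt ?posrE//.
  exact: truncnS_gt.
exists (maxn m n.+1) => // y /DE /(_ n)/(_ (leq_maxr _ _))/lt_trans; apply.
by apply: le_lt_trans em; rewrite lef_pV2 ?posrE// ler_nat ltnS leq_maxl.
Qed.

(** An open set is a countable union of boxes with rational centres, and the preimage of a box is a
    finite intersection of preimages of intervals under the [hat (f i)]. Hence the Borel sets of
    X(B) are no finer than what the [hat a] generate. *)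
Lemma measurable_fun_hat d (Y : measurableType d) (phi : Y -> X B) :
  (forall a, measurable_fun setT (hat a \o phi)) ->
  measurable_fun setT (phi : Y -> borel (X B)).
Proof.
move=> mphi.
apply: (@measurability _ _ Y (borel (X B)) setT phi (@open (X B))) => //.
move=> _ [V oV <-].
rewrite setTI.
(* The radius is half of the one in [nbhs_box]: a rational box whose centre is that close to the
   point then lies in the box around the point, by the triangle inequality. *)
pose bx (nq : nat * seq rat) : set (X B) :=
  box nq.1 [seq ratr q | q <- nq.2] (nq.1.+1.*2%:R^-1).
have mbx nq : measurable (phi @^-1` bx nq).
  rewrite (_ : _ @^-1` _ = \bigcap_(i in `I_nq.1)
      ((hat (f i) \o phi) @^-1` ball ([seq ratr q : R | q <- nq.2]`_i) nq.1.+1.*2%:R^-1)).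
    apply: bigcap_measurableType => i _.
    rewrite -[X in measurable X]setTI; apply: mphi => //.
    by rewrite ball_itv; exact: measurable_itv.
  by apply/seteqP; split=> y /= h i; apply: h.
have -> : phi @^-1` V = \bigcup_(nq in [set nq | bx nq `<=` V]) phi @^-1` bx nq.
  apply/seteqP; split=> [y Vy|y [nq sV] /sV //].
  have [n nV] := nbhs_box (open_nbhs_nbhs (conj oV Vy)).
  pose r : R := n.+1.*2%:R^-1.
  have n0 : 0 < r by rewrite invr_gt0 ltr0n double_gt0.
  have /choice[q qP] : forall i, exists q : rat,
      `|ratr q - hat (f i) (phi y)| < r.
    move=> i; have [|q] := @rat_in_itvoo R (hat (f i) (phi y)) (hat (f i) (phi y) + r).
      by rewrite ltrDl.
    by rewrite in_itv/= => /andP[q1 q2]; exists q; exact: dist_lt_itvoo.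
  exists (n, [seq q i | i <- iota 0 n]).
    move=> /= z bz; apply: nV => i ni; have := bz i ni.
    rewrite /= -map_comp !(nth_map 0%N) ?size_iota// nth_iota//= add0n => bi.
    have -> : n.+1%:R^-1 = r + r :> R.
      by rewrite /r -muln2 natrM invfM -splitr.
    rewrite (_ : _ - _ = (hat (f i) (phi y) - ratr (q i)) +
      (ratr (q i) - hat (f i) z)); last by rewrite addrA subrK.
    by rewrite (le_lt_trans (ler_normD _ _))// ltrD// distrC; exact: qP.
  by move=> i /= ni; rewrite -map_comp (nth_map 0%N) ?size_iota// nth_iota//= add0n.
rewrite bigcup_mkcond; apply: countable_bigcupT_measurable => [|nq].
  exact: countableP.
by case: ifP => // _; exact: mbx.
Qed.

End CountablyGenerated.

(** Compactness yields a cluster point [l]. The ultrafilter contains the preimage of each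
    neighbourhood of [l] or of its complement, and clustering rules out the complement, so [l] is a
    limit. *)
Lemma ultra_cvg_compact (I : Type) (T : topologicalType) (F : set_system I)
    (g : I -> T) (K : set T) :
  UltraFilter F -> compact K -> F (g @^-1` K) -> exists2 l, K l & g @ F --> l.
Proof.
move=> UF cK FK; have [l [Kl cl]] := cK (g @ F) _ FK.
exists l => // V Vl; have [//|FV] := in_ultra_setVsetC (g @^-1` V) UF.
by have [z []] := cl (~` V) V FV Vl.
Qed.

Lemma ultra_cvg_bounded (R : realType) (I : Type) (F : set_system I)
    (g : I -> R) (M : R) :
  UltraFilter F -> F [set i | `|g i| <= M] -> exists l : R, g @ F --> l.
Proof.
move=> UF FM.
have [|l _ gl] := ultra_cvg_compact UF (@segment_compact R (- M) M) (g := g).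
  by apply: filterS FM => i /=; rewrite in_itv/= ler_norml.
by exists l.
Qed.

Section FiniteMeasureRadon.
Context {R : realType} {B : charAlgType R}.
Variable f : nat -> B.
Hypothesis genf : generates f.

Definition hat_bounded (c : nat -> R) : set (X B) :=
  [set y | forall n, `|hat (f n) y| <= c n].

Lemma hat_bounded_bound c (a : B) :
  exists M, forall y, hat_bounded c y -> `|hat a y| <= M.
Proof.
move: a; apply: genf => [|r a b [M aM] [N bN]|a b [M aM] [N bN]|n].
- by exists 1 => y _; rewrite hat1 normr1.
- exists (`|r| * M + N) => y cy; rewrite hatD hatZ (le_trans (ler_normD _ _))//.
  by rewrite lerD ?bN// normrM ler_wpM2l ?aM.
- by exists (M * N) => y cy; rewrite hatM normrM ler_pM ?aM ?bN.
- by exists (c n) => y; exact.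
Qed.

(** Bounds on the generators bound every [hat a], so all of them converge along an ultrafilter on
    the set. The limits respect sums, products and the unit, hence form a character, to which the
    ultrafilter converges. *)
Lemma hat_bounded_compact c : compact (hat_bounded c).
Proof.
rewrite compact_ultra => F UF Fc.
have /choice[l hl] : forall a, exists l : R, hat a @ F --> l.
  move=> a; have [M aM] := hat_bounded_bound c a.
  by apply: (@ultra_cvg_bounded _ _ _ _ M); apply: filterS Fc => y /aM.
have PF : ProperFilter F by exact: ultra_proper.
have uniq (g : X B -> R) (p q : R) : g @ F --> p -> g @ F --> q -> p = q.
  by move=> gp gq; apply: (cvg_unique _ gp gq).
have l_linear : linear_for *%R l.
  move=> r a b; apply: (uniq (hat (r *: a + b))) => //.
  have -> : hat (r *: a + b) = fun y : X B => r * hat a y + hat b y.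
    by apply/funext => y; rewrite hatD hatZ.
  by apply: cvgD => //; apply: cvgMr.
have l_monoid : monoid_morphism l.
  split.
    apply: (uniq (hat 1)) => //.
    have -> : hat 1 = cst 1 :> (X B -> R) by apply/funext => y; exact: hat1.
    exact: cvg_cst.
  move=> a b; apply: (uniq (hat (a * b))) => //.
  have -> : hat (a * b) = fun y : X B => hat a y * hat b y.
    by apply/funext => y; rewrite hatM.
  exact: cvgM.
pose alpha : X B := HB.pack l (GRing.isLinear.Build R B R *%R l l_linear)
  (GRing.isMonoidMorphism.Build B R l l_monoid).
have Falpha : F --> alpha by apply: cvg_hatP => a; exact: hl.
exists alpha; split => // n.
have : (fun y => `|hat (f n) y|) @ F --> `|hat (f n) alpha|.
  by apply: cvg_norm; exact: hl.
move=> /cvg_lim <- //; apply: limr_le.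
  by apply/cvg_ex; eexists; apply: cvg_norm; exact: hl.
by apply: filterS Fc => y; exact.
Qed.

End FiniteMeasureRadon.

(** * Finite measures on countably generated character spaces *)

Section MeasureApproximation.
Local Open Scope ereal_scope.

(** Continuity from above in a form that produces an index: if every term exceeded the measure of
    the intersection by more than [e], so would the limit, up to equality, although the measure is
    finite. *)
Lemma measure_nonincreasing_le d (R : realType) (T : measurableType d)
    (mu : {measure set T -> \bar R}) (F : (set T)^nat) (e : R) :
  mu setT < +oo -> (0 < e)%R -> (forall i, measurable (F i)) ->
  nonincreasing_seq F -> exists n, mu (F n) <= mu (\bigcap_n F n) + e%:E.
Proof.
move=> muT e0 mF niF; apply: contrapT => /forallNP h.
have mI : measurable (\bigcap_n F n) by exact: bigcapT_measurable.
have cF := @nonincreasing_cvg_mu _ _ _ mu F _ mF mI niF.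
have {}cF : mu \o F @ \oo --> mu (\bigcap_n F n).
  by apply: cF; apply: le_lt_trans muT; apply: le_measure; rewrite ?inE.
have : mu (\bigcap_n F n) + e%:E <= mu (\bigcap_n F n).
  rewrite -[leRHS](cvg_lim _ cF)//; apply: lime_ge.
    by apply/cvg_ex; eexists; exact: cF.
  by apply: nearW => n /=; rewrite leNgt; apply/negP => /ltW; exact: h.
apply/negP; rewrite -ltNge lteDl ?lte_fin// ge0_fin_numE//.
by apply: le_lt_trans muT; apply: le_measure; rewrite ?inE.
Qed.

Context {R : realType} {T : ptopologicalType}.
Variable mu : {measure set (borel T) -> \bar R}.
Hypothesis muT : mu setT < +oo.

Let mu_fin M : measurable M -> mu M \is a fin_num.
Proof.
move=> mM; rewrite ge0_fin_numE//.
by apply: le_lt_trans muT; apply: le_measure; rewrite ?inE.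
Qed.

Definition regular_set (M : set (borel T)) := forall e : R, (0 < e)%R ->
  exists F V : set T, [/\ closed F, open V, F `<=` M, M `<=` V &
    mu (V `\` F) <= e%:E].

(** Complements exchange the closed and the open approximant. For a countable union all the open
    sets are kept, but only finitely many closed ones, so that their union remains closed; one half
    of [e] pays for the truncation and the other for the individual errors. *)
Lemma regular_set_sigma_algebra : sigma_algebra setT regular_set.
Proof.
split.
- move=> e e0; exists set0, set0; split=> //; [exact: closed0|exact: open0|].
  by rewrite setD0 measure0 lee_fin ltW.
- move=> M rM e /rM[F [V [cF oV FM MV mVF]]]; exists (~` V), (~` F).
  rewrite setTD; split; [exact: open_closedC|exact: closed_openC|
    exact: subsetC|exact: subsetC|].
  by rewrite setDE setCK setIC -setDE.
- move=> M rM e e0.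
  have e2 i : (0 < e / 2 / (2 ^ i.+1)%:R)%R by rewrite !divr_gt0 ?ltr0n ?expn_gt0.
  have /choice[FV hFV] : forall i, exists FV : set T * set T,
      [/\ closed FV.1, open FV.2, FV.1 `<=` M i, M i `<=` FV.2 &
        mu (FV.2 `\` FV.1) <= (e / 2 / (2 ^ i.+1)%:R)%:E].
    by move=> i; have [F [V h]] := rM i _ (e2 i); exists (F, V).
  have mF i : measurable ((FV i).1 : set (borel T)).
    by apply: measurable_closed; have [] := hFV i.
  have mV i : measurable ((FV i).2 : set (borel T)).
    by apply: measurable_open; have [] := hFV i.
  pose V : set (borel T) := \bigcup_i (FV i).2.
  pose F n : set (borel T) := \bigcup_(i in `I_n) (FV i).1.
  have mbV : measurable V by exact: bigcupT_measurable.
  have mbF n : measurable (F n) by exact: bigcup_measurable.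
  have e20 : (0 < e / 2)%R by rewrite divr_gt0.
  have [n|k m km|n hn] :=
    @measure_nonincreasing_le _ _ _ mu (fun n => V `\` F n) _ muT e20.
  - exact: measurableD.
  - apply/subsetPset; apply: setDS; rewrite /F.
    by move=> x [i /= ik Fx]; exists i => //=; exact: leq_trans ik km.
  exists (F n), V; split.
  - by apply: closed_bigcup => // i _; have [] := hFV i.
  - by apply: bigcup_open => i _; have [] := hFV i.
  - by move=> x [i _ Fx]; exists i => //; have [_ _ + _ _] := hFV i; exact.
  - by move=> x [i _ Mx]; exists i => //; have [_ _ _ + _] := hFV i; exact.
  apply: (le_trans hn); rewrite [in leRHS](splitr e) EFinD leeD2r//.
  apply: (@le_trans _ _ (\sum_(i <oo) mu ((FV i).2 `\` (FV i).1))).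
    apply: measure_sigma_subadditive => [i||x hx].
    + exact: measurableD.
    + by apply: bigcapT_measurable => k; exact: measurableD.
    have [[i _ Vx] _] := hx 0%N I; exists i => //; split=> // Fx.
    (* [F i.+1] is the first finite union that includes the closed set of index [i]. *)
    by have [_] := hx i.+1 I; apply; exists i => /=.
  apply: (@le_trans _ _ (\sum_(i <oo) (e / 2 / (2 ^ i.+1)%:R)%:E)).
    by apply: lee_nneseries => // i _; have [] := hFV i.
  by apply: (epsilon_trick0 xpredT); rewrite divr_ge0// ltW.
Qed.

(** An open set is its own outer approximant, and an exhaustion by closed sets supplies the inner
    one. *)
Lemma regular_set_open (V : set T) (F : nat -> set T) : open V ->
  (forall n, closed (F n)) -> nondecreasing_seq F -> \bigcup_n F n = V ->
  regular_set V.
Proof.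
move=> oV cF ndF FV e e0.
have mV : measurable (V : set (borel T)) by exact: measurable_open.
have mF n : measurable (F n : set (borel T)) by exact: measurable_closed.
have [n|m n mn|n hn] := @measure_nonincreasing_le _ _ _ mu (fun n => V `\` F n) _ muT e0.
- exact: measurableD.
- by apply/subsetPset; apply: setDS; apply/subsetPset; exact: ndF.
exists (F n), V; split => //; first by rewrite -FV; exact: bigcup_sup.
apply: (le_trans hn).
rewrite (_ : \bigcap_n _ = set0) ?measure0 ?add0e//.
apply/seteqP; split=> // x h; have [Vx _] := h 0%N I.
by move: Vx; rewrite -FV => -[k _ Fx]; have [_] := h k I.
Qed.

(** Cutting the closed inner approximant [F] by a compact [C] of nearly full measure makes it
    compact. What is lost of [M] lies in the union of [V] minus [F] and the complement of [C]. *)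
Lemma radon_of_tight : hausdorff_space T ->
  (forall M, measurable M -> regular_set M) ->
  (forall e : R, (0 < e)%R -> exists2 C : set T, compact C & mu (~` C) <= e%:E) ->
  radon mu.
Proof.
move=> hT regM tight; split.
  by move=> x; exists setT => //; split => //; exact: openT.
have mC C : compact C -> measurable (C : set (borel T)).
  by move=> cC; apply: measurable_closed; exact: compact_closed.
move=> M mM; apply/eqP; rewrite eq_le; apply/andP; split; last first.
  apply: ge_ereal_sup => _ [C [cC CM] <-].
  by apply: le_measure; rewrite ?inE//; exact: mC.
apply/lee_addgt0Pr => e e0.
have e20 : (0 < e / 2)%R by rewrite divr_gt0.
have [F [V [cF oV FM MV mVF]]] := regM M mM _ e20.
have [C cC mCe] := tight _ e20.
have cFC : compact (F `&` C).
  by rewrite setIC; exact: compact_closedI.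
have mF : measurable (F : set (borel T)) by exact: measurable_closed.
have mV : measurable (V : set (borel T)) by exact: measurable_open.
apply: (@le_trans _ _ (mu (F `&` C) + e%:E)); last first.
  rewrite leeD2r//; apply: ereal_sup_ubound; exists (F `&` C) => //.
  by split=> // x [/FM].
apply: (@le_trans _ _ (mu ((F `&` C) `|` ((V `\` F) `|` ~` C)))).
  apply: le_measure; rewrite ?inE//.
    by apply: measurableU; [exact: mC|apply: measurableU; [exact: measurableD|
      apply: measurableC; exact: mC]].
  move=> x Mx; have [Fx|Fx] := pselect (F x); last by right; left; split=> //; exact: MV.
  by have [Cx|Cx] := pselect (C x); [left|right; right].
apply: (le_trans (measureU2 _ _ _)); [exact: mC|apply: measurableU; [exact: measurableD|
      apply: measurableC; exact: mC]|].
rewrite leeD2l// (le_trans (measureU2 _ _ _))//; [exact: measurableD|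
      apply: measurableC; exact: mC|].
by rewrite (splitr e) EFinD leeD.
Qed.

End MeasureApproximation.

(* The functions [hat a] are measurable for the sigma-algebra of regular sets. *)
Lemma borel_regular (R : realType) (B : charAlgType R) (f : nat -> B)
    (mu : {measure set (borel (X B)) -> \bar R}) :
  generates f -> (mu setT < +oo)%E -> forall M, measurable M -> regular_set mu M.
Proof.
move=> genf muT M mM.
pose Y := g_sigma_algebraType (regular_set mu).
have mreg (N : set Y) : measurable N -> regular_set mu N.
  have : <<s regular_set mu >> `<=` regular_set mu.
    by apply: smallest_sub => //; exact: regular_set_sigma_algebra.
  exact.
have /(_ measurableT M mM) : measurable_fun setT (id : Y -> borel (X B)).
  apply: (measurable_fun_hat genf) => a.
  apply: (measurability _ (RGenOInfty.measurableE R)) => _ [_ [r ->] <-].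
  rewrite setTI; apply: sub_sigma_algebra.
  pose F n : set (X B) := hat a @^-1` `[r + n.+1%:R^-1, +oo[.
  apply: (@regular_set_open _ _ mu muT _ F).
  - move/continuousP : (@continuous_hat R B a); apply; exact: interval_open.
  - move=> n; apply: closed_comp; last exact: interval_closed.
    by move=> x _; exact: continuous_hat.
  - move=> m n mn; apply/subsetPset => x; rewrite /F /= !in_itv/= !andbT.
    by apply: le_trans; rewrite lerD2l lef_pV2 ?posrE// ler_nat.
  - apply/seteqP; split=> x; rewrite /F /= in_itv/= andbT.
      move=> [n _]; rewrite /= in_itv/= andbT; apply: lt_le_trans.
      by rewrite ltrDl invr_gt0.
    move=> rx; have rx0 : 0 < hat a x - r by rewrite subr_gt0.
    exists (Num.truncn (hat a x - r)^-1) => //=; rewrite in_itv/= andbT.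
    rewrite -lerBrDl ltW// invf_plt ?posrE//; exact: truncnS_gt.
by rewrite setTI; exact: mreg.
Qed.

Lemma finite_measure_radon (R : realType) (B : charAlgType R) (f : nat -> B)
    (mu : {measure set (borel (X B)) -> \bar R}) :
  generates f -> (mu setT < +oo)%E -> radon mu.
Proof.
move=> genf muT; apply: radon_of_tight => //; first exact: X_hausdorff.
  exact: borel_regular genf muT.
move=> e e0.
have e2 i : (0 < e / (2 ^ i.+1)%:R)%R by rewrite !divr_gt0 ?ltr0n ?expn_gt0.
pose E n c : set (borel (X B)) := [set y | c < `|hat (f n) y|].
have mE n c : measurable (E n c).
  apply: measurable_open; rewrite /E.
  have -> : [set y | c < `|hat (f n) y|] = hat (f n) @^-1` [set r | c < `|r|] by [].
  move/continuousP : (@continuous_hat R B (f n)); apply.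
  rewrite (_ : [set r | _] = (fun r : R => `|r|) @^-1` `]c, +oo[).
    by move/continuousP : (@norm_continuous R R); apply; exact: interval_open.
  by apply/seteqP; split=> r /=; rewrite in_itv/= andbT.
(* Characters are real-valued, so the sets [E n m%:R] decrease to the empty set as [m] grows, and
   some level leaves at most the allotted mass. *)
have /choice[c hc] : forall n, exists c : R, (mu (E n c) <= (e / (2 ^ n.+1)%:R)%:E)%E.
  move=> n; have [m|i j ij|m] :=
    @measure_nonincreasing_le _ _ _ mu (fun m => E n m%:R) _ muT (e2 n).
  - exact: mE.
  - by apply/subsetPset => x; rewrite /E/=; apply: le_lt_trans; rewrite ler_nat.
  rewrite (_ : \bigcap_m _ = set0) ?measure0 ?add0e; first by exists m%:R.
  apply/seteqP; split=> // x /= /(_ (Num.truncn `|hat (f n) x|).+1 I).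
  by rewrite /E/= ltNge => /negP; apply; rewrite ltW// truncnS_gt.
exists (hat_bounded f c); first exact: hat_bounded_compact.
have -> : ~` hat_bounded f c = \bigcup_n E n (c n).
  apply/seteqP; split=> x.
    by move=> /existsNP[n /negP]; rewrite -ltNge => h; exists n.
  by move=> [n _]; rewrite /E/= ltNge => /negP h k; apply: h; exact: k.
apply: (@le_trans _ _ (\sum_(n <oo) mu (E n (c n)))%E).
  by apply: generalized_Boole_inequality => //; exact: bigcupT_measurable.
apply: (@le_trans _ _ (\sum_(i <oo) (e / (2 ^ i.+1)%:R)%:E)%E).
  by apply: lee_nneseries => // i _; exact: hc.
by apply: (epsilon_trick0 xpredT); rewrite ltW.
Qed.

(** * Extension of contents from compact sets *)

Section CompactSeparation.
Context {T : topologicalType}.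

Definition separated_by_open (K L : set T) :=
  exists U V, [/\ open U, open V, K `<=` U, L `<=` V & U `&` V = set0].

Lemma separated_by_openC K L : separated_by_open K L -> separated_by_open L K.
Proof. by move=> [U [V [oU oV KU LV UV]]]; exists V, U; rewrite setIC. Qed.

(** Compactness of [L] is used as a near-covering property along the filter of small neighbourhoods
    of [K]: each point of [L] has a neighbourhood avoiding the closure of every small enough [U],
    hence a single [U] serves all of [L]. An empty [K] is treated apart because its neighbourhood
    filter is not proper. *)
Lemma separated_by_open_compact K L : compact L ->
  (forall y, L y -> separated_by_open K [set y]) -> separated_by_open K L.
Proof.
move=> /compact_near_coveringP cL sepL.
have [->|/set0P[k0 Kk0]] := eqVneq K set0.
  by exists set0, setT; split=> //; [exact: open0|exact: openT|rewrite set0I].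
pose F := powerset_filter_from (set_nbhs K).
have PK : ProperFilter (set_nbhs K) by apply: set_nbhs_pfilter; exists k0.
have FF : ProperFilter F by exact: powerset_filter_from_filter.
have cvP (y : T) : L y -> \forall y' \near y & U \near F, (~` closure U) y'.
  move=> /sepL[U [V [oU oV KU yV UV]]].
  have nU : set_nbhs K U by apply/set_nbhsP; exists U; split=> // ?.
  have nV : nbhs y V by apply: open_nbhs_nbhs; split=> //; exact: yV.
  near=> y' W => /=.
  have WU : W `<=` U by exact: (near (small_set_sub nU) W).
  have Vy' : V y' by exact: (near nV y').
  move=> /(_ _ (open_nbhs_nbhs (conj oV Vy')))[z [/WU Uz Vz]].
  by have : (U `&` V) z by []; rewrite UV.
have [Q /= [QF _ [U QU] QL]] := cL _ _ _ _ cvP.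
have /set_nbhsP[W [oW KW WU]] := QF _ QU.
exists W, (~` closure U); split => //.
- by apply: closed_openC; exact: closed_closure.
- exact: QL.
- by apply/disjoints_subset; rewrite setCK => x /WU; exact: subset_closure.
Unshelve. all: by end_near. Qed.

Hypothesis hT : hausdorff_space T.

(** Two passes of the previous lemma: the Hausdorff property separates a point [y] of [L] from each
    point of [K], hence from [K]; then [K] is separated from all of [L]. *)
Lemma compact_separated (K L : set T) : compact K -> compact L -> K `&` L = set0 ->
  separated_by_open K L.
Proof.
move=> cK cL KL; apply: separated_by_open_compact => // y Ly.
apply: separated_by_openC; apply: separated_by_open_compact => // x Kx.
have xy : y != x.
  by apply/eqP => yx; rewrite yx in Ly; have : (K `&` L) x by []; rewrite KL.
move: hT; rewrite open_hausdorff => /(_ _ _ xy)[[U V] /= [yU xV] [oU oV UV]].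
exists U, V; split=> // [z ->|z ->|]; [exact: set_mem|exact: set_mem|exact/eqP].
Qed.

(** The parts of [K] outside [U] and outside [V] are disjoint compact sets. Removing from [K]
    disjoint open neighbourhoods [P] and [Q] of them leaves the two pieces. *)
Lemma compact_setU_split (K U V : set T) : compact K -> open U -> open V ->
  K `<=` U `|` V ->
  exists K1 K2 : set T, [/\ compact K1, compact K2, K1 `<=` U, K2 `<=` V & K = K1 `|` K2].
Proof.
move=> cK oU oV KUV.
have [] := @compact_separated (K `&` ~` U) (K `&` ~` V).
- by apply: compact_closedI => //; exact: open_closedC.
- by apply: compact_closedI => //; exact: open_closedC.
- apply/seteqP; split=> // x [[Kx nU] [_ nV]].
  by have [] := KUV _ Kx.
move=> P [Q [oP oQ KP KQ PQ]].
exists (K `&` ~` P), (K `&` ~` Q); split.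
- by apply: compact_closedI => //; exact: open_closedC.
- by apply: compact_closedI => //; exact: open_closedC.
- by move=> x [Kx nP]; apply: contrapT => nU; apply: nP; exact: KP.
- by move=> x [Kx nP]; apply: contrapT => nU; apply: nP; exact: KQ.
by rewrite -setIUr -setCI PQ setC0 setIT.
Qed.

End CompactSeparation.

Section ContentExtension.
Local Open Scope ereal_scope.
Context {R : realType} {T : ptopologicalType}.
Hypothesis hT : hausdorff_space T.
Variables (lam : set T -> R) (m : R).
Hypothesis lam_ge0 : forall K, compact K -> (0 <= lam K)%R.
Hypothesis lam_lem : forall K, compact K -> (lam K <= m)%R.
Hypothesis lam_sub : forall K L, compact K -> compact L ->
  (lam (K `|` L) <= lam K + lam L)%R.
Hypothesis lam_add : forall K L, compact K -> compact L -> K `&` L = set0 ->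
  (lam K + lam L <= lam (K `|` L))%R.
Hypothesis lam_tight : forall e : R, (0 < e)%R ->
  exists2 C, compact C & (m - e <= lam C)%R.

(** The inner content induced by [lam], intended for open [V]; the next definition is the outer
    measure that it induces. *)
Definition inner_content (V : set T) : \bar R :=
  ereal_sup [set (lam K)%:E | K in [set K | compact K /\ K `<=` V]].

Definition outer_content (E : set T) : \bar R :=
  ereal_inf [set inner_content V | V in [set V | open V /\ E `<=` V]].

Let lam0 : lam set0 = 0%R.
Proof.
apply/eqP; rewrite eq_le lam_ge0 ?andbT; last exact: compact0.
have := @lam_add set0 set0 (@compact0 _) (@compact0 _) (set0I _).
by rewrite setU0 gerDl.
Qed.

Lemma inner_content_ge0 V : 0 <= inner_content V.
Proof.
by apply: ereal_sup_ubound; exists set0; rewrite ?lam0//; split=> //; exact: compact0.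
Qed.

Lemma inner_content_le V : inner_content V <= m%:E.
Proof. by apply: ge_ereal_sup => _ [K [cK _] <-]; rewrite lee_fin lam_lem. Qed.

Lemma inner_content_homo U V : U `<=` V -> inner_content U <= inner_content V.
Proof.
move=> UV; apply: ereal_sup_le => _ [K [cK KU] <-]; exists K => //.
by split=> //; exact: subset_trans UV.
Qed.

Lemma le_inner_content K V : compact K -> K `<=` V -> (lam K)%:E <= inner_content V.
Proof. by move=> cK KV; apply: ereal_sup_ubound; exists K. Qed.

Lemma content_bigsetU (U : (set T)^nat) n K : (forall i, open (U i)) ->
  compact K -> K `<=` \bigcup_(i < n) U i ->
  (lam K)%:E <= \sum_(0 <= i < n) inner_content (U i).
Proof.
move=> oU; elim: n K => [|n ih] K cK.
  rewrite bigcup_mkord big_ord0 subset0 => ->.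
  by rewrite big_nil lam0.
rewrite bigcup_mkord big_ord_recr/= -bigcup_mkord => KU.
have oUn : open (\bigcup_(i < n) U i) by exact: bigcup_open.
have [K1 [K2 [cK1 cK2 K1U K2U KE]]] := compact_setU_split hT cK oUn (oU n) KU.
rewrite big_nat_recr//=; apply: (@le_trans _ _ ((lam K1)%:E + (lam K2)%:E)).
  by rewrite KE -EFinD lee_fin lam_sub.
by apply: leeD; [exact: ih|exact: le_inner_content].
Qed.

(** A compact subset of the union is already covered by finitely many of the [U i], which reduces
    the claim to finite subadditivity. *)
Lemma inner_content_bigcup (U : (set T)^nat) : (forall i, open (U i)) ->
  inner_content (\bigcup_i U i) <= \sum_(i <oo) inner_content (U i).
Proof.
move=> oU; apply: ge_ereal_sup => _ [K [cK KU] <-].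
have cvP (x : T) : K x -> \forall x' \near x & n \near \oo,
    (\bigcup_(i < n) U i) x'.
  move=> /KU[i _ Ux].
  have nU : nbhs x (U i) by apply: open_nbhs_nbhs.
  near=> x' n; exists i => /=; last by near: x'.
  by near: n; exact: nbhs_infty_gt.
have [N _ hN] := (iffLR (compact_near_coveringP K)) cK _ _ _ _ cvP.
apply: (le_trans (content_bigsetU oU cK (hN N (leqnn N)))).
by apply: nneseries_lim_ge => *; exact: inner_content_ge0.
Unshelve. all: by end_near. Qed.

Lemma outer_content_open V : open V -> outer_content V = inner_content V.
Proof.
move=> oV; apply/eqP; rewrite eq_le; apply/andP; split.
  by apply: ereal_inf_lbound; exists V => //; split.
by apply: le_ereal_inf_tmp => _ [U [oU VU] <-]; exact: inner_content_homo.
Qed.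

Lemma outer_content_ge0 E : 0 <= outer_content E.
Proof. by apply: le_ereal_inf_tmp => _ [V _ <-]; exact: inner_content_ge0. Qed.

Lemma outer_content_le E V : open V -> E `<=` V ->
  outer_content E <= inner_content V.
Proof. by move=> oV EV; apply: ereal_inf_lbound; exists V. Qed.

Lemma outer_content_fin E : outer_content E \is a fin_num.
Proof.
rewrite ge0_fin_numE ?outer_content_ge0//.
apply: (@le_lt_trans _ _ m%:E); last exact: ltry.
apply: le_trans (inner_content_le setT).
by apply: outer_content_le => //; exact: openT.
Qed.

Lemma outer_content_homo E F : E `<=` F -> outer_content E <= outer_content F.
Proof.
move=> EF; apply: le_ereal_inf_tmp => _ [V [oV FV] <-].
by apply: outer_content_le => //; exact: subset_trans FV.
Qed.

Lemma outer_content_adherent E (e : R) : (0 < e)%R ->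
  exists V, [/\ open V, E `<=` V & inner_content V <= outer_content E + e%:E].
Proof.
move=> e0; have [_ [V [oV EV] <-] Ve] := lb_ereal_inf_adherent e0 (outer_content_fin E).
by exists V; split=> //; exact: ltW.
Qed.

Lemma outer_content_sigma_subadditive : sigma_subadditive outer_content.
Proof.
move=> E; apply/lee_addgt0Pr => e e0.
have e2 i : (0 < e / (2 ^ i.+1)%:R)%R by rewrite !divr_gt0 ?ltr0n ?expn_gt0.
have /choice[V hV] : forall i, exists V, [/\ open V, E i `<=` V &
    inner_content V <= outer_content (E i) + (e / (2 ^ i.+1)%:R)%:E].
  by move=> i; exact: outer_content_adherent.
apply: (@le_trans _ _ (inner_content (\bigcup_i V i))).
  apply: outer_content_le; first by apply: bigcup_open => i _; have [] := hV i.
  by move=> x [i _ Ex]; exists i => //; have [_ + _] := hV i; exact.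
apply: (@le_trans _ _ (\sum_(i <oo) inner_content (V i))).
  by apply: inner_content_bigcup => i; have [] := hV i.
apply: le_trans (epsilon_trick xpredT _ (ltW e0)); last first.
  by move=> i; exact: outer_content_ge0.
by apply: lee_nneseries => [i _ _|i _]; [exact: inner_content_ge0|have [] := hV i].
Qed.

Lemma outer_content0 : outer_content set0 = 0.
Proof.
rewrite outer_content_open; last exact: open0.
apply/eqP; rewrite eq_le inner_content_ge0 andbT.
by apply: ge_ereal_sup => _ [K [_ +] <-]; rewrite subset0 => ->; rewrite lam0.
Qed.

Let mu : {outer_measure set T -> \bar R} :=
  HB.pack outer_content (isOuterMeasure.Build R T outer_content outer_content0
    outer_content_ge0 outer_content_homo outer_content_sigma_subadditive).

(** It suffices to split open sets [V] containing the test set. For [K] compact in the part of [V]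
    inside [U], the part outside [U] is covered by the open set [V] minus [K]. Any compact [C] there
    is disjoint from [K], so superadditivity bounds [lam K + lam C] by the inner content of [V]. *)
Lemma open_caratheodory U : open U -> mu.-caratheodory U.
Proof.
move=> oU; apply: le_caratheodory_measurable => E.
apply: le_ereal_inf_tmp => _ [V [oV EV] <-].
apply: (@le_trans _ _ (inner_content (V `&` U) + outer_content (V `&` ~` U))).
  apply: leeD; last by apply: outer_content_homo; exact: setSI.
  by apply: outer_content_le; [exact: openI|exact: setSI].
rewrite -leeBrDr ?outer_content_fin//.
apply: ge_ereal_sup => _ [K [cK KVU] <-].
rewrite leeBrDr ?outer_content_fin// -leeBrDl//.
have oVK : open (V `&` ~` K).
  by apply: openI => //; apply: closed_openC; exact: compact_closed.
apply: (@le_trans _ _ (inner_content (V `&` ~` K))).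
  by apply: outer_content_le => // x [Vx nU]; split=> // /KVU[].
apply: ge_ereal_sup => _ [C [cC CVK] <-]; rewrite leeBrDl//.
apply: (@le_trans _ _ (lam (K `|` C))%:E).
  rewrite -EFinD lee_fin lam_add//; apply/seteqP; split=> // x [Kx].
  by move=> /CVK[].
apply: le_inner_content; first exact: compactU.
by move=> x [/KVU[]|/CVK[]].
Qed.

Lemma borel_caratheodory (M : set (borel T)) : measurable M -> mu.-caratheodory M.
Proof.
have : <<s @open T >> `<=` mu.-caratheodory; last exact.
apply: smallest_sub; last exact: open_caratheodory.
split; first exact: caratheodory_measurable_set0.
- by move=> A mA; rewrite setTD; exact: caratheodory_measurable_setC.
- by move=> F mF; exact: caratheodory_measurable_bigcup.
Qed.

Lemma content_sigma_additive :
  semi_sigma_additive (outer_content : set (borel T) -> \bar R).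
Proof.
move=> F mF tF mUF.
have := @caratheodory_measure_sigma_additive R T mu F _ tF _.
by apply=> [i|]; exact: borel_caratheodory.
Qed.

Definition content_measure : {measure set (borel T) -> \bar R} :=
  HB.pack (outer_content : set (borel T) -> \bar R)
    (isMeasure.Build _ (borel T) R outer_content outer_content0 
      outer_content_ge0 content_sigma_additive).

(** The bound on [lam] gives one inequality; tightness prevents mass from escaping and gives the
    other. *)
Lemma content_measureT : content_measure setT = m%:E.
Proof.
apply/eqP; rewrite eq_le; apply/andP; split; rewrite /content_measure/=.
  by rewrite outer_content_open ?inner_content_le//; exact: openT.
apply/lee_addgt0Pr => e /lam_tight[C cC mC].
rewrite outer_content_open; last exact: openT.
rewrite -leeBlDr//; apply: le_trans (le_inner_content cC (@subsetT _ _)).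
by rewrite -EFinB lee_fin.
Qed.

(** Open approximations of [M] and of its complement from outside give the open and the closed set
    needed for regularity. Tightness of the measure comes from that of [lam]. *)
Lemma content_measure_radon : radon content_measure.
Proof.
have muT : content_measure setT < +oo by rewrite content_measureT ltry.
have mfin (M : set (borel T)) : measurable M -> content_measure M \is a fin_num.
  move=> mM; rewrite ge0_fin_numE//.
  by apply: le_lt_trans muT; apply: le_measure; rewrite ?inE.
apply: radon_of_tight => //.
- move=> M mM e e0; have e20 : (0 < e / 2)%R by rewrite divr_gt0.
  have [V [oV MV Ve]] := outer_content_adherent M e20.
  have [W [oW MW We]] := outer_content_adherent (~` M) e20.
  exists (~` W), V; split=> //; first exact: open_closedC.
    by move=> x nW; apply: contrapT => nM; apply: nW; exact: MW.
  have mV : measurable (V : set (borel T)) by exact: measurable_open.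
  have mW : measurable (W : set (borel T)) by exact: measurable_open.
  have hD (N P : set (borel T)) : measurable N -> measurable P -> N `<=` P ->
      content_measure P <= content_measure N + (e / 2)%:E ->
      content_measure (P `\` N) <= (e / 2)%:E.
    move=> mN mP NP; rewrite measureD//; last first.
      by rewrite -ge0_fin_numE// mfin.
    by rewrite (setIidr NP) leeBlDl ?mfin.
  have mM' : measurable (~` M) by exact: measurableC.
  have hV : content_measure (V `\` M) <= (e / 2)%:E.
    by apply: hD => //; rewrite /content_measure/= (outer_content_open oV).
  have hW : content_measure (W `\` ~` M) <= (e / 2)%:E.
    by apply: hD => //; rewrite /content_measure/= (outer_content_open oW).
  apply: (@le_trans _ _ (content_measure ((V `\` M) `|` (W `\` ~` M)))).
    apply: le_measure; rewrite ?inE//.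
    + by apply: measurableD => //; exact: measurableC.
    + by apply: measurableU; exact: measurableD.
    + move=> x [Vx /contrapT Wx]; have [Mx|Mx] := pselect (M x); last by left.
      by right; split=> //; apply.
  apply: (le_trans (measureU2 _ _ _)); [exact: measurableD|exact: measurableD|].
  by rewrite (splitr e) EFinD leeD.
- move=> e /lam_tight[C cC mC]; exists C => //.
  have oC : open (~` C) by apply: closed_openC; exact: compact_closed.
  rewrite /content_measure/= (outer_content_open oC).
  apply: ge_ereal_sup => _ [K [cK KC] <-]; rewrite lee_fin.
  (* A compact [K] that misses [C] satisfies [lam K + lam C <= m], and [lam C] is within [e] of
     [m]. *)
  have := @lam_add K C cK cC; rewrite -disjoints_subset in KC => /(_ KC).
  have := lam_lem (compactU cK cC).
  by lra.
Qed.

Lemma content_measure_open V (e : R) : open V -> (0 < e)%R ->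
  exists K, [/\ compact K, K `<=` V & content_measure V <= (lam K + e)%:E].
Proof.
move=> oV e0; have Vfin := outer_content_fin V.
have [|_ [K [cK KV] <-] Ve] := @ub_ereal_sup_adherent _ 
  [set (lam K)%:E | K in [set K | compact K /\ K `<=` V]] e e0.
  by move: Vfin; rewrite (outer_content_open oV).
exists K; split=> //; rewrite /content_measure/= (outer_content_open oV).
by rewrite EFinD -leeBlDr// ltW.
Qed.

End ContentExtension.

(** * Layer sums *)

Section Layers.
Local Open Scope ereal_scope.
Context {R : realType}.
Implicit Types (c y : R) (m : nat).

(* Lower Riemann sum of [t |-> 1_{t < y}] on the grid [c, 2c, .., mc]. *)
Definition layer c m y : R := (\sum_(0 <= j < m) c * ((j.+1%:R * c < y)%R)%:R)%R.

Lemma layerS c m y :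
  layer c m.+1 y = (layer c m y + c * ((m.+1%:R * c < y)%R)%:R)%R.
Proof. by rewrite /layer big_nat_recr. Qed.

Lemma layer_ge0 c m y : (0 <= c)%R -> (0 <= layer c m y)%R.
Proof. by move=> c0; apply: sumr_ge0 => j _; rewrite mulr_ge0. Qed.

Lemma layer_le c m y : (0 <= c)%R -> (0 <= y)%R -> (layer c m y <= y)%R.
Proof.
(* The second bound strengthens the induction: when level [m.+1] is counted, the preceding ones add
   up to at most [m%:R * c]. *)
move=> c0 y0; suff /andP[] : (layer c m y <= y)%R && (layer c m y <= m%:R * c)%R by [].
elim: m => [|m /andP[ih1 ih2]]; first by rewrite /layer big_nil mul0r y0 lexx.
have mE : (m.+1%:R * c = m%:R * c + c :> R)%R by rewrite -natr1 mulrDl mul1r.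
rewrite layerS; case: ltP => my; rewrite ?mulr1 ?mulr0 ?addr0; rewrite mE in my *.
  by rewrite lerD2r ih2 andbT (le_trans _ (ltW my))// lerD2r.
by rewrite ih1 (le_trans ih2)// lerDl.
Qed.

Lemma layer_ge c m y : (0 <= c)%R -> (y <= m.+1%:R * c)%R -> (y <= layer c m y + c)%R.
Proof.
(* Invariant: either the sum has come within [c] of [y], or every level so far has been counted. *)
move=> c0 ym; suff : (y <= layer c m y + c \/ m.+1%:R * c <= layer c m y + c)%R.
  by case=> // h; exact: le_trans ym h.
elim: m {ym} => [|m ih]; first by right; rewrite /layer big_nil add0r mul1r.
have mE : (m.+2%:R * c = m.+1%:R * c + c :> R)%R by rewrite -natr1 mulrDl mul1r.
rewrite layerS; case: ltP => my; rewrite ?mulr1 ?mulr0 ?addr0.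
  right; rewrite mE lerD2r; case: ih => // h; exact: le_trans (ltW my) h.
left; case: ih => // h; exact: le_trans my h.
Qed.

Lemma measurable_superlevel d (T : measurableType d) (h : T -> R) (r : R) :
  measurable_fun setT h -> measurable [set x | (r < h x)%R].
Proof.
move=> mh; rewrite (_ : [set x | _] = h @^-1` `]r, +oo[%classic)%R.
  by rewrite -[X in measurable X]setTI; apply: mh => //; exact: measurable_itv.
by apply/seteqP; split=> x /=; rewrite in_itv/= andbT.
Qed.

Lemma integral_layer d (T : measurableType d) (mu : {measure set T -> \bar R})
    (h : T -> R) c m : (0 <= c)%R -> measurable_fun setT h ->
  \int[mu]_x (layer c m (h x))%:E =
  \sum_(0 <= j < m) c%:E * mu [set x | (j.+1%:R * c < h x)%R].
Proof.
move=> c0 mh.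
have mV j : measurable [set x | (j.+1%:R * c < h x)%R] by exact: measurable_superlevel.
transitivity (\int[mu]_x \sum_(0 <= j < m)
    (c%:E * (\1_[set x | (j.+1%:R * c < h x)%R] x)%:E)).
  apply: eq_integral => x _; rewrite sumEFin; congr EFin.
  apply: eq_bigr => j _; rewrite indicE; congr (c * (nat_of_bool _)%:R)%R.
  by apply/idP/idP => [jh|/set_mem//]; apply/mem_set.
rewrite ge0_integral_sum//; last 2 first.
  by move=> j; apply: measurable_funeM; apply/measurable_EFinP; exact: measurable_indic.
  by move=> j x _; rewrite -EFinM lee_fin mulr_ge0.
apply: eq_bigr => j _; rewrite ge0_integralZl//.
- by rewrite integral_indic// setIT.
- by apply/measurable_EFinP; exact: measurable_indic.
Qed.

Lemma measurable_layer d (T : measurableType d) (h : T -> R) c m :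
  measurable_fun setT h -> measurable_fun setT (fun x => (layer c m (h x))%:E).
Proof.
move=> mh; apply/measurable_EFinP; apply: measurable_sum => j.
apply: measurable_funM => //.
have mV : measurable [set x | (j.+1%:R * c < h x)%R] by exact: measurable_superlevel.
rewrite (_ : (fun _ => _) = \1_[set x | (j.+1%:R * c < h x)%R]).
  exact: measurable_indic.
apply/funext => x; rewrite indicE; congr ((nat_of_bool _)%:R)%R.
by apply/idP/idP => [jh|/set_mem//]; apply/mem_set.
Qed.

Lemma layer_sum_le_integral d (T : measurableType d) (mu : {measure set T -> \bar R})
    (h : T -> R) c m : (0 <= c)%R -> measurable_fun setT h -> (forall x, 0 <= h x)%R ->
  \sum_(0 <= j < m) c%:E * mu [set x | (j.+1%:R * c < h x)%R] <= \int[mu]_x (h x)%:E.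
Proof.
move=> c0 mh h0; rewrite -integral_layer//; apply: ge0_le_integral => //.
- by move=> x _; rewrite lee_fin layer_ge0.
- exact: measurable_layer.
- exact/measurable_EFinP.
- by move=> x _; rewrite lee_fin layer_le.
Qed.

(** Layer sums on finer and longer grids converge pointwise to [h], and Fatou's lemma carries the
    uniform bound over to the integral. *)
Lemma integral_le_layers d (T : measurableType d) (mu : {measure set T -> \bar R})
    (h : T -> R) (r : R) : measurable_fun setT h -> (forall x, 0 <= h x)%R ->
  (forall c m, (0 <= c)%R ->
    \sum_(0 <= j < m) c%:E * mu [set x | (j.+1%:R * c < h x)%R] <= r%:E) ->
  \int[mu]_x (h x)%:E <= r%:E.
Proof.
move=> mh h0 hr.
(* With mesh [n.+1%:R^-1], taking the square of [n.+1] as the number of levels makes the grid reach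
   [n.+1], so the mesh vanishes while the range becomes unbounded. *)
pose s n x := (layer n.+1%:R^-1 (n.+1 * n.+1)%N (h x))%:E.
have cs x : s ^~ x @ \oo --> (h x)%:E.
  apply: cvg_EFin; first by apply: nearW.
  apply/cvgrPdist_le => e e0; near=> n.
  have n0 : (0 <= n.+1%:R^-1 :> R)%R by rewrite invr_ge0.
  rewrite /= ger0_norm ?subr_ge0 ?layer_le// lerBlDl.
  apply: (@le_trans _ _ (layer n.+1%:R^-1 (n.+1 * n.+1) (h x) + n.+1%:R^-1)%R).
    apply: layer_ge => //; apply: (@le_trans _ _ n.+1%:R).
      by apply: le_trans (ltW (truncnS_gt _)) _; rewrite ler_nat; near: n;
        exists (Num.truncn (h x)) => // n /=; rewrite ltnS.
    rewrite ler_pdivlMr// -natrM ler_nat; exact: leqnSn.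
  rewrite lerD2l; near: n; exists (Num.truncn e^-1) => // n /= en.
  rewrite invf_ple ?posrE//; apply: le_trans (ltW (truncnS_gt _)) _.
  by rewrite ler_nat ltnS.
have -> : \int[mu]_x (h x)%:E = \int[mu]_x limn_einf (s ^~ x).
  by apply: eq_integral => x _; have [-> _] := cvg_limn_einf_sup (cs x).
apply: le_trans (fatou _ _ _ _) _ => //.
- by move=> n; exact: measurable_layer.
- by move=> n x _; rewrite lee_fin layer_ge0// invr_ge0.
rewrite limn_einf_lim; apply: lime_le; first exact: is_cvg_einfs.
apply: nearW => n; apply: (@le_trans _ _ (\int[mu]_x s n x)).
  by apply: ereal_inf_lbound; exists n => /=.
by rewrite integral_layer ?invr_ge0//; apply: hr; rewrite invr_ge0.
Unshelve. all: by end_near. Qed.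

End Layers.

(** * The limit measure under Prokhorov's condition *)

Section RepresentingFacts.
Local Open Scope ereal_scope.
Context {R : realType} {B : charAlgType R}.

Lemma representing_total (l : {scalar B}) (G : set (set (X B)))
    (nu : {measure set (g_sigma_algebraType G) -> \bar R}) :
  l 1%R = 1%R -> representing l setT nu -> nu setT = 1.
Proof.
move=> l1 [_ _ _ /(_ 1%R)]; rewrite l1 => <-.
rewrite (eq_integral (cst 1)) => [|x _]; first by rewrite integral_cst ?mul1e.
by rewrite hat1.
Qed.

Lemma compact_measurable (C : set (X B)) : compact C ->
  measurable (C : set (borel (X B))).
Proof.
move=> cC; apply: measurable_closed; apply: compact_closed => //.
exact: X_hausdorff.
Qed.

Lemma hat_sqr_ge0 (a : B) (x : X B) : (0 <= hat (a * a) x)%R.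
Proof. by rewrite hatM -expr2 sqr_ge0. Qed.

End RepresentingFacts.

Section UltraLimit.
Context {R : realType} {A : charAlgType R}.

(** Any ultrafilter refining the tails of the directed set of finitely generated subalgebras will
    do; each tail is nonempty because a finite set generates such a subalgebra. *)
Lemma subalgebra_ultrafilter : exists U : set_system (subalgClosed A),
  [/\ UltraFilter U, U fin_gen & forall a : A, U [set T | a \in T]].
Proof.
pose D (F : set A) : set (subalgClosed A) := [set T | fin_gen T /\ F `<=` [set` T]].
have PD : ProperFilter (filter_from finite_set D).
  apply: filter_from_proper => [|F fF]; last first.
    by exists (gen F); split; [exact: gen_fin_gen|exact: sub_gen].
  apply: filter_from_filter; first by exists set0; exact: finite_set0.
  move=> F G fF fG; exists (F `|` G); first by rewrite finite_setU.
  by move=> T [fT FGT]; split; split=> // a ?; apply: FGT; [left|right].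
have [U [UU DU]] := ultraFilterLemma PD.
exists U; split=> //.
  by apply: DU; exists set0; [exact: finite_set0|move=> T []].
move=> a; apply: DU; exists [set a]; first exact: finite_set1.
by move=> T [_]; apply.
Qed.

(** Two distinct characters differ at some [a], and the same [a] separates all nearby pairs. By
    compactness of the product of [K] and [L], the condition that [T] contains a separating element
    holds for all pairs at once, for [T] far enough along [U]. *)
Lemma restrA_separates (U : set_system (subalgClosed A)) (K L : set (X A)) :
  Filter U -> (forall a : A, U [set T | a \in T]) ->
  compact K -> compact L -> K `&` L = set0 ->
  \forall T \near U, restrA T @` K `&` restrA T @` L = set0.
Proof.
move=> FU aU cK cL KL.
pose P (T : subalgClosed A) (xy : X A * X A) :=
  exists2 a, a \in T & hat a xy.1 != hat a xy.2.
have h : \forall T \near U, K `*` L `<=` P T.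
  have /compact_near_coveringP cKL : compact (K `*` L) by exact: compact_setX.
  apply: cKL => -[x y] /= [Kx Ly].
  have [a axy] : exists a, hat a x != hat a y.
    apply: contrapT => h; have xy : x = y.
      apply: eq_character => a; apply/eqP; apply/negPn/negP => axy.
      by apply: h; exists a.
    have : (K `&` L) x by split=> //; rewrite xy.
    by rewrite KL.
  move: (@Rhausdorff R); rewrite open_hausdorff => /(_ _ _ axy)[[V W] /=].
  rewrite !inE => -[Vx Wy] [oV oW VW].
  exists ((hat a @^-1` V) `*` (hat a @^-1` W), [set T : subalgClosed A | a \in T]) => /=.
    split; last exact: aU.
    exists (hat a @^-1` V, hat a @^-1` W) => //=; split.
      by apply: (@continuous_hat R A a); apply: open_nbhs_nbhs.
    by apply: (@continuous_hat R A a); apply: open_nbhs_nbhs.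
  move=> [[x' y'] T] /= [[Vx' Wy'] aT]; exists a => //=; apply/eqP => axy'.
  have : (V `&` W) (hat a x') by split=> //=; rewrite axy'.
  by rewrite VW.
near=> T.
apply/seteqP; split=> // _ [[x Kx <-] [y Ly yx]].
have hT : K `*` L `<=` P T by near: T.
have [|a aT /eqP] := hT (x, y); [by []|apply].
have : hat (Sub a aT : carrier T) (restrA T x) = hat (Sub a aT : carrier T) (restrA T y).
  by rewrite yx.
by rewrite /restrA /restr /hat/= /inclA_fun.
Unshelve. all: by end_near. Qed.

End UltraLimit.

Section ProkhorovLimit.
Context {R : realType} {A : charAlgType R}.
Variables (L : {scalar A}) (L1 : L 1 = 1).
Variable mu : measure_family A.
Hypothesis mu_rep : forall S, fin_gen S -> radon_representing (L \o inclA S) setT (mu S).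
Hypothesis mu_pro : prokhorov mu.
Variable U : set_system (subalgClosed A).
Hypothesis UU : UltraFilter U.
Hypothesis Ufin : U fin_gen.
Hypothesis Umem : forall a : A, U [set T : subalgClosed A | a \in T].

Let UP : ProperFilter U.
Proof. exact: ultra_proper. Qed.

Lemma family_total S : fin_gen S -> (mu S setT = 1)%E.
Proof.
move=> /mu_rep[rep _]; apply: (representing_total _ rep) => /=.
by rewrite rmorph1.
Qed.

Let trace (T : subalgClosed A) (K : set (X A)) : R := fine (mu T (restrA T @` K)).

Let restrA_compact T (K : set (X A)) : compact K -> compact (restrA T @` K).
Proof.
move=> cK; apply: continuous_compact => //.
by apply: continuous_subspaceT; exact: continuous_restr.
Qed.

Let mu_le1 T (M : set (borel (X (carrier T)))) : fin_gen T -> measurable M ->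
  (mu T M <= 1)%E.
Proof.
by move=> fT mM; rewrite -(family_total fT); apply: le_measure; rewrite ?inE.
Qed.

Let mu_fin T (M : set (borel (X (carrier T)))) : fin_gen T -> measurable M ->
  mu T M \is a fin_num.
Proof.
by move=> fT mM; rewrite ge0_fin_numE//; apply: le_lt_trans (mu_le1 fT mM) (ltry _).
Qed.

Let traceE T (K : set (X A)) : fin_gen T -> compact K ->
  (mu T (restrA T @` K) = (trace T K)%:E)%E.
Proof.
move=> fT cK; rewrite fineK// mu_fin//.
by apply: compact_measurable; exact: restrA_compact.
Qed.

Definition limit_content (K : set (X A)) : R := lim (trace ^~ K @ U).

Lemma limit_contentP K : compact K -> trace ^~ K @ U --> limit_content K.
Proof.
move=> cK; suff : cvg (trace ^~ K @ U) by [].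
have [|l hl] := @ultra_cvg_bounded R _ U (trace ^~ K) 1 UU; last first.
  by apply/cvg_ex; exists l.
apply: filterS Ufin => T fT /=; rewrite ger0_norm ?fine_ge0//.
rewrite -lee_fin -traceE//; apply: mu_le1 => //.
by apply: compact_measurable; exact: restrA_compact.
Qed.

Lemma limit_content_ge0 K : compact K -> 0 <= limit_content K.
Proof.
move=> cK; apply: (cvgr_to_ge (limit_contentP cK)); apply: nearW => T.
by rewrite fine_ge0.
Qed.

Lemma limit_content_le1 K : compact K -> limit_content K <= 1.
Proof.
move=> cK; apply: (cvgr_to_le (limit_contentP cK)).
apply: filterS Ufin => T fT; rewrite -lee_fin -traceE//; apply: mu_le1 => //.
by apply: compact_measurable; exact: restrA_compact.
Qed.

Let limit_content_le (f g : subalgClosed A -> R) (p q : R) :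
  f @ U --> p -> g @ U --> q -> (\forall T \near U, f T <= g T) -> p <= q.
Proof.
move=> fp gq fg; rewrite -subr_ge0; apply: (cvgr_to_ge (cvgB gq fp)).
by apply: filterS fg => T; rewrite subr_ge0.
Qed.

Lemma limit_content_sub K K' : compact K -> compact K' ->
  limit_content (K `|` K') <= limit_content K + limit_content K'.
Proof.
move=> cK cK'; have cKK' := compactU cK cK'.
apply: (limit_content_le (limit_contentP cKK')
  (cvgD (limit_contentP cK) (limit_contentP cK'))).
apply: filterS Ufin => T fT; rewrite -lee_fin /= EFinD -!traceE// image_setU.
by apply: measureU2; apply: compact_measurable; exact: restrA_compact.
Qed.

Lemma limit_content_add K K' : compact K -> compact K' -> K `&` K' = set0 ->
  limit_content K + limit_content K' <= limit_content (K `|` K').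
Proof.
move=> cK cK' KK'; have cU := compactU cK cK'.
apply: (limit_content_le (cvgD (limit_contentP cK) (limit_contentP cK'))
  (limit_contentP cU)).
have dU : U [set T | restrA T @` K `&` restrA T @` K' = set0].
  exact: restrA_separates.
apply: filterS (filterI Ufin dU) => T [fT dT].
rewrite -lee_fin /= EFinD -!traceE// image_setU.
by rewrite measureU//; apply: compact_measurable; exact: restrA_compact.
Qed.

Lemma limit_content_tight (e : R) : 0 < e ->
  exists2 C, compact C & 1 - e <= limit_content C.
Proof.
move=> /mu_pro[C cC hC]; exists C => //.
apply: (cvgr_to_ge (limit_contentP cC)).
by apply: filterS Ufin => T fT; rewrite -lee_fin -traceE//; exact: hC.
Qed.

Definition limit_measure : {measure set (borel (X A)) -> \bar R} :=
  content_measure (@X_hausdorff R A) limit_content_ge0 limit_content_le1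
    limit_content_sub limit_content_add.

Local Notation nu := limit_measure.

Lemma limit_measureT : (nu setT = 1)%E.
Proof. exact: content_measureT limit_content_tight. Qed.

Lemma limit_measure_radon : radon nu.
Proof. exact: content_measure_radon limit_content_tight. Qed.

(** Each superlevel set is open, hence approximated by a compact [K j]. For [T] containing [a], the
    image of [K j] lies in the corresponding superlevel set on X(T), so the layer sum of traces is
    at most the integral over X(T), which is [L (a * a)]; the bound survives the limit along [U]. *)
Lemma limit_measure_sqr a : (\int[nu]_x (hat (a * a) x)%:E <= (L (a * a))%:E)%E.
Proof.
apply: integral_le_layers; [exact: measurable_hat|exact: hat_sqr_ge0|].
move=> c m c0; pose V j : set (X A) := [set x | j.+1%:R * c < hat (a * a) x].
have oV j : open (V j) by exact: open_hat_gt.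
apply/lee_addgt0Pr => e e0.
(* The error per level is chosen so that [m] errors weighted by [c] total at most [e]; the added
   ones keep the denominator positive when [m] or [c] is zero. *)
have d0 : 0 < e / (m.+1%:R * (c + 1)) by rewrite divr_gt0// mulr_gt0// ltr_wpDl.
set d := e / _ in d0.
have /choice[K hK] : forall j, exists K, [/\ compact K, K `<=` V j &
    (nu (V j) <= (limit_content K + d)%:E)%E].
  by move=> j; exact: content_measure_open.
have cK j : compact (K j) by have [] := hK j.
have sumK : \sum_(0 <= j < m) c * limit_content (K j) <= L (a * a).
  have cvK : (fun T => \sum_(0 <= j < m) c * trace T (K j)) @ U -->
      \sum_(0 <= j < m) c * limit_content (K j).
    elim: (m) => [|k ih].
      under eq_fun do rewrite big_nil.
      by rewrite big_nil; exact: cvg_cst.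
    under eq_fun do rewrite big_nat_recr//=.
    rewrite big_nat_recr//=; apply: cvgD => //.
    by apply: cvgMr; exact: limit_contentP.
  apply: (cvgr_to_le cvK).
  near=> T.
  have fT : fin_gen T by near: T; exact: Ufin.
  have aT : a \in T by near: T; exact: Umem.
  pose b : carrier T := Sub a aT.
  have [[_ _ _ /(_ (b * b)) bL] _] := mu_rep fT.
  rewrite -lee_fin.
  apply: (@le_trans _ _ (\int[mu T]_x (hat (b * b) x)%:E)%E); last first.
    by rewrite bL lee_fin /= rmorphM.
  apply: le_trans (layer_sum_le_integral (mu T) m c0
    (@measurable_hat R _ (b * b)) (@hat_sqr_ge0 R _ b)).
  rewrite -sumEFin; apply: lee_sum => j _; rewrite EFinM lee_wpmul2l ?lee_fin//.
  rewrite -traceE//; apply: le_measure; rewrite ?inE.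
  - by apply: compact_measurable; exact: restrA_compact.
  - by apply: measurable_open; exact: open_hat_gt.
  - move=> _ [x Kx <-]; have [_ /(_ _ Kx) Vx _] := hK j.
    change (j.+1%:R * c < hat (b * b) (restrA T x)).
    by rewrite hatM -[hat b _]/(hat a x) -hatM.
apply: (@le_trans _ _ (\sum_(0 <= j < m) c * (limit_content (K j) + d))%:E).
  rewrite -sumEFin; apply: lee_sum => j _; rewrite EFinM lee_wpmul2l ?lee_fin//.
  by have [] := hK j.
rewrite -EFinD lee_fin; under eq_bigr do rewrite mulrDr.
rewrite big_split/= lerD// sumr_const_nat subn0.
rewrite -mulr_natl /d mulrA mulrA ler_pdivrMr; last by rewrite mulr_gt0// ltr_wpDl.
rewrite mulrC ler_wpM2l ?(ltW e0)// ler_pM ?ler_nat//.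
by rewrite lerDl.
Unshelve. all: by end_near. Qed.

End ProkhorovLimit.

(* Replacing [a] by [a + t] turns the inequality into one that is affine in [t]. *)
Lemma representing_of_sqr (R : realType) (B : charAlgType R) (l : {scalar B})
    (nu : {measure set (borel (X B)) -> \bar R}) :
  l 1 = 1 -> (nu setT = 1)%E ->
  (forall a, (\int[nu]_x (hat (a * a) x)%:E <= (l (a * a))%:E)%E) ->
  representing l setT nu.
Proof.
move=> l1 nu1 nul.
have mhat a : measurable_fun setT (fun x : borel (X B) => (hat a x)%:E).
  by apply/measurable_EFinP; exact: measurable_hat.
have isqr a : nu.-integrable setT (fun x => (hat (a * a) x)%:E).
  apply/integrableP; split=> //; apply: le_lt_trans (ltry (l (a * a))).
  apply: le_trans (nul a); apply: ge0_le_integral => //.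
  - by apply: measurableT_comp.
  - by move=> x _; rewrite /= ger0_norm// hat_sqr_ge0.
have i1 : nu.-integrable setT (fun x => (hat 1 x)%:E).
  by have := isqr 1; rewrite mulr1.
have ihat a : nu.-integrable setT (fun x => (hat a x)%:E).
  (* Domination by the elementary bound of [|y|] by [1 + y ^+ 2], with both terms on the right
     integrable. *)
  apply: (@le_integrable _ _ _ nu setT measurableT _
    (fun x => (hat 1 x)%:E + (hat (a * a) x)%:E)%E) => //; last exact: integrableD.
  move=> x _; rewrite -EFinD !abse_EFin lee_fin hat1 hatM -expr2.
  rewrite [leRHS]ger0_norm ?addr_ge0 ?sqr_ge0//.
  rewrite ler_norml; apply/andP; split; nra.
pose J a := fine (\int[nu]_x (hat a x)%:E)%E.
have JE a : (\int[nu]_x (hat a x)%:E = (J a)%:E)%E.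
  by rewrite fineK//; exact: integrable_fin_num.
have JD a b : J (a + b) = J a + J b.
  apply: EFin_inj; rewrite EFinD -!JE -integralD//.
  by apply: eq_integral => x _; rewrite hatD.
have JZ c a : J (c *: a) = c * J a.
  apply: EFin_inj; rewrite EFinM -!JE -integralZl//.
  by apply: eq_integral => x _; rewrite hatZ.
have J1 : J 1 = 1.
  apply: EFin_inj; rewrite -JE (eq_integral (cst 1%E)) => [|x _]; last by rewrite hat1.
  by rewrite integral_cst// mul1e nu1.
have Jle a : J (a * a) <= l (a * a) by rewrite -lee_fin -JE.
split => //; [exact: (@measurableT _ (borel (X B)))|by rewrite setCT measure0|move=> a].
rewrite JE; congr EFin.
have h t : J (a * a) - l (a * a) + 2 * t * (J a - l a) <= 0.
  have := Jle (a + t *: 1).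
  have -> : (a + t *: 1) * (a + t *: 1) = a * a + (2 * t) *: a + (t * t) *: 1.
    rewrite mulrDl !mulrDr -!scalerAl -!scalerAr !mulr1 !mul1r scalerA.
    by rewrite !addrA -(addrA (a * a)) -scalerDl -mulr2n mulr_natl.
  by rewrite !JD !JZ J1 !linearD !linearZ l1 /=; lra.
apply/eqP; rewrite -subr_eq0; apply/negPn/negP => q0.
(* This [t] makes the left-hand side of [h] equal to [1], a contradiction. *)
have := h ((1 - (J (a * a) - l (a * a))) / (2 * (J a - l a))).
rewrite (_ : 2 * _ * _ = 1 - (J (a * a) - l (a * a))).
  by rewrite addrC subrK ler10.
by rewrite mulrAC mulrC divfK// mulf_neq0// pnatr_eq0.
Qed.

(** * Restrictions and projective limits *)

Lemma pushforward_measure_exists d1 d2 (T1 : measurableType d1)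
    (T2 : measurableType d2) (R : realType) (mu : {measure set T1 -> \bar R})
    (phi : T1 -> T2) : measurable_fun setT phi ->
  exists nu : {measure set T2 -> \bar R},
    (nu : set T2 -> \bar R) = pushforward mu phi.
Proof.
move=> mphi; pose nu : set T2 -> \bar R := pushforward mu phi.
have nu0 : nu set0 = 0%E by rewrite /nu /pushforward preimage_set0 measure0.
have nu_ge0 M : (0 <= nu M)%E by exact: measure_ge0.
have nu_sigma : semi_sigma_additive nu.
  move=> F mF tF mUF; rewrite /nu /pushforward preimage_bigcup.
  apply: measure_semi_sigma_additive.
  - by move=> n; rewrite -[X in measurable X]setTI; exact: mphi.
  - apply/trivIsetP => /= i j _ _ ij; rewrite -preimage_setI.
    by move/trivIsetP : tF => /(_ _ _ _ _ ij) ->//; rewrite preimage_set0.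
  - by rewrite -preimage_bigcup -[X in measurable X]setTI; exact: mphi.
pose m : {measure set T2 -> \bar R} :=
  HB.pack nu (isMeasure.Build _ T2 R nu nu0 nu_ge0 nu_sigma).
by exists m.
Qed.

Section Restriction.
Context {R : realType} {A : charAlgType R}.

Lemma restrS_restrA (S T : subalgClosed A) (ST : {subset S <= T}) x :
  restrS ST (restrA T x) = restrA S x.
Proof. exact: eq_character. Qed.

Lemma measurable_restrA (S : subalgClosed A) :
  measurable_fun setT (restrA S : borel (X A) -> borel (X (carrier S))).
Proof. by apply: continuous_measurable_borel; exact: continuous_restr. Qed.

Lemma measurable_restrS (S T : subalgClosed A) (ST : {subset S <= T}) :
  measurable_fun setT
    (restrS ST : borel (X (carrier T)) -> borel (X (carrier S))).
Proof. by apply: continuous_measurable_borel; exact: continuous_restr. Qed.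

Lemma measurable_restrA_cylinder_fin (S : subalgClosed A) : fin_gen S ->
  measurable_fun setT
    (restrA S : g_sigma_algebraType (cylinder A) -> borel (X (carrier S))).
Proof.
move=> fS _ M mM; apply: sub_sigma_algebra; exists S => //.
by exists M.
Qed.

Lemma measurable_hat_cylinder (a : A) :
  measurable_fun setT (hat a : g_sigma_algebraType (cylinder A) -> R).
Proof.
pose S := gen [set a].
have aS : a \in S by apply: (@sub_gen _ _ [set a]).
have -> : hat a = hat (Sub a aS : carrier S) \o restrA S by [].
apply: (measurableT_comp (@measurable_hat R _ _)).
by apply: measurable_restrA_cylinder_fin; exact: gen_fin_gen.
Qed.

(** Countable generation reduces measurability to the functions [hat b], and each of these factors
    through the subalgebra generated by one element. This is how a sigma-algebra defined from
    finitely generated subalgebras also handles the countably generated ones. *)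
Lemma measurable_restrA_cylinder (T : subalgClosed A) : countably_gen T ->
  measurable_fun setT
    (restrA T : g_sigma_algebraType (cylinder A) -> borel (X (carrier T))).
Proof.
move=> /countably_gen_generates[f genf]; apply: (measurable_fun_hat genf) => b.
exact: measurable_hat_cylinder.
Qed.

Variables (L : {scalar A}) (L1 : L 1 = 1).
Variable G : set (set (X A)).
Variable nu : {measure set (g_sigma_algebraType G) -> \bar R}.
Hypothesis nu_rep : representing L setT nu.

Let nu1 : (nu setT = 1)%E.
Proof. exact: representing_total nu_rep. Qed.

(** The integrals follow by change of variables, and the Radon property is automatic on a countably
    generated algebra. The sigma-algebra [G] is left general to serve both the cylinder and the
    Borel case. *)
Lemma restriction_radon_representing (S : subalgClosed A)
    (nuS : {measure set (borel (X (carrier S))) -> \bar R}) :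
  countably_gen S ->
  measurable_fun setT (restrA S : g_sigma_algebraType G -> borel (X (carrier S))) ->
  (nuS : set (borel (X (carrier S))) -> \bar R) = 
    pushforward nu (restrA S : g_sigma_algebraType G -> borel (X (carrier S))) ->
  radon_representing (L \o inclA S) setT nuS /\ radon_probability nuS.
Proof.
move=> cS mS nuSE; have [f genf] := countably_gen_generates cS.
have nuS1 : (nuS setT = 1)%E by rewrite nuSE /pushforward preimage_setT.
have rS : radon nuS.
  by apply: (finite_measure_radon genf); rewrite nuS1 ltry.
do 2 split=> //.
case: nu_rep => _ _ inu Inu.
have mb (b : carrier S) : measurable_fun setT
    (fun x : borel (X (carrier S)) => (hat b x)%:E).
  by apply/measurable_EFinP; exact: measurable_hat.
split.
- exact: (@measurableT _ (borel (X (carrier S)))).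
- by rewrite setCT measure0.
- move=> b; rewrite nuSE; apply: (integrable_pushforward mS (mb b) _ measurableT).
  by rewrite preimage_setT; exact: (inu (\val b)).
- move=> b; rewrite nuSE (integral_pushforward mS (mb b) _ measurableT); last first.
    by rewrite preimage_setT; exact: (inu (\val b)).
  by rewrite preimage_setT; exact: (Inu (\val b)).
Qed.

End Restriction.

(** * Families obtained by pushing a representing measure forward *)

Section Necessity.
Context {R : realType} {A : charAlgType R} (L : {scalar A}) (L1 : L 1 = 1).

Lemma cylinder_measure_restrictions
    (mu : {measure set (g_sigma_algebraType (cylinder A)) -> \bar R}) :
  representing L setT mu ->
  exists muS : measure_family A,
    [/\ (forall S, fin_gen S -> radon_representing (L \o inclA S) setT (muS S)),
        exact_system fin_gen muS &
        exists2 muL : measure_family A, corresponding muS muL & thick muL].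
Proof.
move=> mu_rep.
have ex T : exists nu : {measure set (borel (X (carrier T))) -> \bar R},
    countably_gen T ->
    (nu : set (borel (X (carrier T))) -> \bar R) = pushforward mu
      (restrA T : g_sigma_algebraType (cylinder A) -> borel (X (carrier T))).
  have [cT|ncT] := pselect (countably_gen T).
    have [nu nuE] := pushforward_measure_exists mu (measurable_restrA_cylinder cT).
    by exists nu.
  (* Default value for subalgebras that are not countably generated, where [restrA T] need not be
     measurable for the cylinder sigma-algebra. *)
  by exists mzero.
pose muL : measure_family A := fun T => projT1 (cid (ex T)).
have muLE T : countably_gen T ->
    (muL T : set (borel (X (carrier T))) -> \bar R) = pushforward mu
      (restrA T : g_sigma_algebraType (cylinder A) -> borel (X (carrier T))).
  exact: (projT2 (cid (ex T))).
have rep T : countably_gen T ->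
    radon_representing (L \o inclA T) setT (muL T) /\ radon_probability (muL T).
  move=> cT; apply: (restriction_radon_representing L1 mu_rep cT) => //.
    exact: measurable_restrA_cylinder.
  exact: muLE.
have exactL (S T : subalgClosed A) (ST : {subset S <= T}) :
    countably_gen S -> countably_gen T -> forall M,
    pushforward (muL T) (restrS ST : borel _ -> borel _) M = muL S M.
  move=> cS cT M; rewrite /pushforward (muLE S)// (muLE T)// /pushforward.
  congr (mu _); apply/seteqP; split=> x /=; by rewrite restrS_restrA.
(* The same family of push-forwards serves for both index sets. *)
exists muL; split.
- by move=> S /fin_gen_countably_gen/rep[].
- by move=> S T ST /fin_gen_countably_gen cS /fin_gen_countably_gen cT M _; exact: exactL.
- exists muL.
    move=> T cT; split; first by have [] := rep _ cT.
    by move=> S ST /fin_gen_countably_gen cS M _; exact: exactL.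
  move=> T cT M mM TM; rewrite muLE// /pushforward.
  rewrite (_ : _ @^-1` _ = set0) ?measure0//.
  apply/seteqP; split=> // x /= Mx.
  by have : (range (restrA T) `&` M) (restrA T x) by []; rewrite TM.
Qed.

Lemma radon_measure_restrictions (nu : {measure set (borel (X A)) -> \bar R}) :
  radon_representing L setT nu ->
  exists mu : measure_family A,
    (forall S, fin_gen S -> radon_representing (L \o inclA S) setT (mu S)) /\
    prokhorov mu.
Proof.
move=> [nu_rep [_ nu_inner]].
have ex T := pushforward_measure_exists nu (@measurable_restrA _ _ T).
pose mu : measure_family A := fun T => projT1 (cid (ex T)).
have muE T : (mu T : set (borel (X (carrier T))) -> \bar R) =
    pushforward nu (restrA T : borel (X A) -> borel (X (carrier T))).
  exact: (projT2 (cid (ex T))).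
have nu1 : (nu setT = 1)%E by exact: representing_total nu_rep.
exists mu; split.
  move=> S /fin_gen_countably_gen cS.
  have [] // := restriction_radon_representing L1 nu_rep cS _ (muE S).
  exact: measurable_restrA.
(* Inner regularity of the whole space yields a compact [C] of measure above [1 - e]. It is
   contained in the preimage of each of its images, so one [C] works for all subalgebras. *)
move=> e e0; have supE := nu_inner setT measurableT; rewrite nu1 in supE.
have [|_ [C [cC _] <-] hC] := ub_ereal_sup_adherent e0 
  (S := [set nu C | C in [set C : set (X A) | compact C /\ C `<=` setT]]).
  by rewrite -supE.
exists C => // S _; rewrite muE /pushforward.
apply: (@le_trans _ _ (nu C)); first by move: hC; rewrite -supE EFinB => /ltW.
apply: le_measure; rewrite ?inE; first exact: compact_measurable.
- rewrite -[X in measurable X]setTI; apply: measurable_restrA => //.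
  apply: compact_measurable; apply: continuous_compact => //.
  by apply: continuous_subspaceT; exact: continuous_restr.
- exact: preimage_image.
Qed.

End Necessity.

(** * The projective limit on the cylinder sigma-algebra *)

Section Sufficiency.
Context {R : realType} {A : charAlgType R}.

Lemma restrS_comp (S T V : subalgClosed A) (ST : {subset S <= T})
    (TV : {subset T <= V}) (SV : {subset S <= V}) x :
  restrS ST (restrS TV x) = restrS SV x.
Proof.
apply: eq_character => a; rewrite /restrS /restr /hat/=; congr (x _).
exact: val_inj.
Qed.

Variables (mu muL : measure_family A).
Hypothesis mu_muL : corresponding mu muL.

(** A pi-system generating the Borel sets of X(S) for countably generated [S], on which
    [corresponding] prescribes the values of the measure. *)
Let fin_cylinder (S : subalgClosed A) : set (set (X (carrier S))) :=
  [set E | exists (V : subalgClosed A) (VS : {subset V <= S})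
     (N : set (borel (X (carrier V)))),
     [/\ fin_gen V, measurable N & E = restrS VS @^-1` N]].

Let fin_cylinder_measurable S :
  @fin_cylinder S `<=` (measurable : set (set (borel (X (carrier S))))).
Proof.
move=> _ [V [VS [N [fV mN ->]]]]; rewrite -[X in measurable X]setTI.
exact: (measurable_restrS VS).
Qed.

Let fin_cylinder_setI S : setI_closed (@fin_cylinder S).
Proof.
move=> _ _ [V1 [VS1 [N1 [fV1 mN1 ->]]]] [V2 [VS2 [N2 [fV2 mN2 ->]]]].
have [V [fV V1V V2V Vmin]] := fin_gen_setU fV1 fV2.
have VS := Vmin S VS1 VS2.
exists V, VS, ((restrS V1V @^-1` N1) `&` (restrS V2V @^-1` N2)); split=> //.
  by apply: measurableI; rewrite -[X in measurable X]setTI; exact: measurable_restrS.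
by apply/seteqP; split=> x /=; rewrite (restrS_comp V1V VS VS1) (restrS_comp V2V VS VS2).
Qed.

Let fin_cylinder_generates S (M : set (borel (X (carrier S)))) : countably_gen S ->
  measurable M -> <<s @fin_cylinder S >> M.
Proof.
move=> /countably_gen_generates[f genf] mM.
have /(_ measurableT M mM) : measurable_fun setT
    (id : g_sigma_algebraType (@fin_cylinder S) -> borel (X (carrier S))).
  apply: (measurable_fun_hat genf) => a.
  pose V := gen [set \val a].
  have aV : \val a \in V by apply: (@sub_gen _ _ [set \val a]).
  have VS : {subset V <= S} by apply: gen_sub => _ ->; exact: valP.
  have -> : hat a \o id = hat (Sub (\val a) aV : carrier V) \o restrS VS.
    apply/funext => x; rewrite /= /restrS /restr /hat/=; congr (x _).
    exact: val_inj.
  apply: (measurableT_comp (@measurable_hat R _ _)) => _ N mN.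
  rewrite setTI; apply: sub_sigma_algebra.
  by exists V, VS, N; split=> //; exact: gen_fin_gen.
by rewrite setTI.
Qed.

(** On a cylinder over a finitely generated [V], both the push-forward of [muL T] and [muL S] give
    the value of [mu V]. Finite measures that agree on a generating pi-system containing the whole
    space agree. *)
Lemma corresponding_exact : exact_system countably_gen muL.
Proof.
move=> S T ST cS cT M mM.
have [m mE] := pushforward_measure_exists (muL T) (measurable_restrS ST).
rewrite -mE.
have [[_ muS1] muSE] := mu_muL cS.
have [[_ muT1] muTE] := mu_muL cT.
have cylT (k : nat) : fin_cylinder ([set: X (carrier S)]).
  have VS : {subset gen set0 <= S} by exact: gen_sub.
  exists (gen set0), VS, setT; split=> //.
  by apply: gen_fin_gen; exact: finite_set0.
have coverT : \bigcup_(k : nat) [set: X (carrier S)] = setT.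
  by apply/seteqP; split=> // x _; exists 0%N.
apply: (@g_sigma_algebra_measure_unique _ R (borel (X (carrier S)))
  (@fin_cylinder S) (@fin_cylinder_measurable S) (fun=> setT) cylT coverT
  m (muL S) (@fin_cylinder_setI S)).
- move=> _ [V [VS [N [fV mN ->]]]].
  have VT : {subset V <= T} by move=> a /VS/ST.
  have := muSE V VS fV N mN; rewrite /pushforward => ->.
  have := muTE V VT fV N mN; rewrite mE /pushforward => <-.
  by congr (muL T _); apply/seteqP; split=> x /=; rewrite (restrS_comp VS ST VT).
- by move=> _; rewrite mE /pushforward preimage_setT muT1 ltry.
- exact: fin_cylinder_generates.
Qed.

Hypothesis thickL : thick muL.

(** Both sets are pulled back to a common countably generated [V]. The part of the first outside the
    second misses the image of X(A), so thickness makes it null. *)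
Lemma thick_le (S T : subalgClosed A) (M : set (borel (X (carrier S))))
    (N : set (borel (X (carrier T)))) :
  countably_gen S -> countably_gen T -> measurable M -> measurable N ->
  restrA S @^-1` M `<=` restrA T @^-1` N -> (muL S M <= muL T N)%E.
Proof.
move=> cS cT mM mN MN.
have [|V cV TV] := @countably_gen_bigcup _ _ (fun n => if n is 0%N then S else T).
  by case.
have SV := TV 0%N; have {}TV := TV 1%N.
have mM' : measurable (restrS SV @^-1` M : set (borel (X (carrier V)))).
  by rewrite -[X in measurable X]setTI; exact: (measurable_restrS SV).
have mN' : measurable (restrS TV @^-1` N : set (borel (X (carrier V)))).
  by rewrite -[X in measurable X]setTI; exact: (measurable_restrS TV).
rewrite -(corresponding_exact SV)// -(corresponding_exact TV)// /pushforward.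
set M' := restrS SV @^-1` M in mM' *; set N' := restrS TV @^-1` N in mN' *.
have D0 : muL V (M' `\` N') = 0%E.
  apply: thickL => //; first exact: measurableD.
  apply/seteqP; split=> // _ [[x _ <-] []] /=.
  by rewrite /M' /N' /= !restrS_restrA => /MN.
apply: (@le_trans _ _ (muL V (N' `|` (M' `\` N')))).
  apply: le_measure; rewrite ?inE//.
    by apply: measurableU => //; exact: measurableD.
  by move=> x Mx; have [Nx|Nx] := pselect (N' x); [left|right].
apply: (le_trans (measureU2 _ _ _)) => //; first exact: measurableD.
by rewrite [X in (_ + X)%E]D0 adde0.
Qed.

Definition cylinder_value (E : set (X A)) : set \bar R :=
  [set v | exists (T : subalgClosed A) (M : set (borel (X (carrier T)))),
     [/\ countably_gen T, measurable M, E = restrA T @^-1` M & v = muL T M]].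

(* By thickness this infimum is over a single value on the cylinder sigma-algebra. *)
Definition projective_limit (E : set (g_sigma_algebraType (cylinder A))) : \bar R :=
  ereal_inf (cylinder_value E).

Lemma projective_limitE (T : subalgClosed A) (M : set (borel (X (carrier T)))) :
  countably_gen T -> measurable M ->
  projective_limit (restrA T @^-1` M) = muL T M.
Proof.
move=> cT mM; apply/eqP; rewrite eq_le; apply/andP; split.
  by apply: ereal_inf_lbound; exists T, M.
apply: le_ereal_inf_tmp => _ [S [N [cS mN TS ->]]].
by apply: thick_le => //; rewrite TS.
Qed.

(** The sets of this form already form a sigma-algebra: the countably many subalgebras involved in a
    union lie in a single countably generated one. *)
Lemma cylinder_setE (E : set (g_sigma_algebraType (cylinder A))) : measurable E ->
  exists (T : subalgClosed A) (M : set (borel (X (carrier T)))),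
    [/\ countably_gen T, measurable M & E = restrA T @^-1` M].
Proof.
pose P (E : set (X A)) := exists (T : subalgClosed A) (M : set (borel (X (carrier T)))),
    [/\ countably_gen T, measurable M & E = restrA T @^-1` M].
have : <<s cylinder A >> `<=` P; last exact.
apply: smallest_sub; last first.
  move=> _ [S fS [N mN <-]]; exists S, N; rewrite setTI; split=> //.
  exact: fin_gen_countably_gen.
split.
- exists (gen set0), set0; split=> //.
  by apply: gen_countably_gen; exact: countable0.
- move=> _ [T [M [cT mM ->]]]; exists T, (~` M); split=> //.
    exact: measurableC.
  by rewrite setTD preimage_setC.
- move=> F h; pose T n := projT1 (cid (h n)).
  have hT n : exists M, _ := projT2 (cid (h n)).
  pose M n := projT1 (cid (hT n)); have hM n := projT2 (cid (hT n)).
  have [|V cV TV] := @countably_gen_bigcup _ _ T; first by move=> n; have [] := hM n.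
  exists V, (\bigcup_n (restrS (TV n) @^-1` M n)); split=> //.
    apply: bigcupT_measurable => n; rewrite -[X in measurable X]setTI.
    by apply: (measurable_restrS (TV n)) => //; have [] := hM n.
  rewrite preimage_bigcup; apply: eq_bigcupr => n _.
  by have [_ _ ->] := hM n; apply/seteqP; split=> x /=; rewrite restrS_restrA.
Qed.

Lemma projective_limit_sigma_additive : semi_sigma_additive projective_limit.
Proof.
move=> F mF tF mUF.
pose T n := projT1 (cid (cylinder_setE (mF n))).
have hT n : exists M, _ := projT2 (cid (cylinder_setE (mF n))).
pose M n := projT1 (cid (hT n)); have hM n := projT2 (cid (hT n)).
have [|V cV TV] := @countably_gen_bigcup _ _ T; first by move=> n; have [] := hM n.
pose N n : set (borel (X (carrier V))) := restrS (TV n) @^-1` M n.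
have mN n : measurable (N n).
  rewrite -[X in measurable X]setTI.
  by apply: (measurable_restrS (TV n)) => //; have [] := hM n.
have FN n : F n = restrA V @^-1` N n.
  by have [_ _ ->] := hM n; apply/seteqP; split=> x /=; rewrite /N /= restrS_restrA.
(* Disjointness of the [F n] only makes the [N n] disjoint on the image of X(A). Replacing them by
   [seqDU N] makes them disjoint in X(V) without changing their preimages. *)
have FD n : F n = restrA V @^-1` (seqDU N n).
  apply/seteqP; split=> x; last by case=> Nx _; rewrite FN.
  move=> Fx; split; first by move: Fx; rewrite {1}FN.
  rewrite -bigcup_mkord => -[k /= kn Nk].
  have nk : n = k by apply: tF => //; exists x; split=> //; rewrite FN.
  by rewrite nk ltnn in kn.
have mD n : measurable (seqDU N n).
  by apply: measurableD => //; apply: bigsetU_measurable => i _.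
have -> : (fun n => \sum_(0 <= i < n) projective_limit (F i))%E =
    (fun n => \sum_(0 <= i < n) muL V (seqDU N i))%E.
  apply/funext => n; apply: eq_bigr => i _.
  by rewrite FD projective_limitE.
have -> : \bigcup_n F n = restrA V @^-1` (\bigcup_n seqDU N n).
  by rewrite preimage_bigcup; apply: eq_bigcupr => n _; exact: FD.
rewrite projective_limitE//; last exact: bigcupT_measurable.
apply: measure_semi_sigma_additive => //.
exact: bigcupT_measurable.
Qed.

Lemma projective_limit_ge0 E : (0 <= projective_limit E)%E.
Proof.
by apply: le_ereal_inf_tmp => _ [T [M [_ mM _ ->]]]; exact: measure_ge0.
Qed.

Lemma projective_limit0 : projective_limit set0 = 0%E.
Proof.
have cT : countably_gen (gen set0 : subalgClosed A).
  by apply: gen_countably_gen; exact: countable0.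
by have := projective_limitE cT measurable0; rewrite preimage_set0 measure0.
Qed.

Lemma projective_limit_representing (L : {scalar A}) :
  (forall S, fin_gen S -> radon_representing (L \o inclA S) setT (mu S)) ->
  exists nu : {measure set (g_sigma_algebraType (cylinder A)) -> \bar R},
    representing L setT nu.
Proof.
move=> rep.
pose nu : {measure set (g_sigma_algebraType (cylinder A)) -> \bar R} :=
  HB.pack projective_limit (isMeasure.Build _ _ R projective_limit
    projective_limit0 projective_limit_ge0 projective_limit_sigma_additive).
have key (a : A) : nu.-integrable setT (fun x => (hat a x)%:E) /\
    (\int[nu]_x (hat a x)%:E = (L a)%:E)%E.
  (* The integral of [hat a] involves a single element, so it can be computed on the finitely
     generated algebra [S], where the image of [nu] is [mu S]. *)
  pose S := gen [set a].
  have aS : a \in S by apply: (@sub_gen _ _ [set a]).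
  have fS : fin_gen S by apply: gen_fin_gen; exact: finite_set1.
  have mS := measurable_restrA_cylinder_fin fS.
  pose b : carrier S := Sub a aS.
  have [nuS nuSE] := pushforward_measure_exists nu mS.
  have nuS_mu M : measurable M -> nuS M = mu S M.
    move=> mM; rewrite nuSE.
    have cS := fin_gen_countably_gen fS.
    (* Correspondence is applied to the inclusion of [S] in itself, whose restriction map is the
       identity, to identify [muL S] with [mu S]. *)
    have [_ /(_ S (fun _ => id) fS M mM) <-] := mu_muL cS.
    rewrite /pushforward [LHS](projective_limitE cS mM).
    by congr (muL S _); apply/seteqP; split=> x /=;
      rewrite (_ : restrS _ x = x)//; apply: eq_character => c;
      rewrite /restrS /restr /hat/=; congr (x _); exact: val_inj.
  have mb : measurable_fun setT (fun x : borel (X (carrier S)) => (hat b x)%:E).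
    by apply/measurable_EFinP; exact: measurable_hat.
  have eq_int (g : X (carrier S) -> \bar R) :
      (\int[nuS]_x g x = \int[mu S]_x g x)%E.
    by apply: eq_measure_integral => M mM _; exact: nuS_mu.
  have [[_ _ /(_ b)/integrableP[_ ib] /(_ b) Ib] _] := rep S fS.
  have inu : nu.-integrable setT (fun x => (hat a x)%:E).
    apply/integrableP; split.
      by apply/measurable_EFinP; exact: measurable_hat_cylinder.
    apply: le_lt_trans ib; rewrite -eq_int nuSE.
    rewrite (ge0_integral_pushforward mS)//; last exact: measurableT_comp.
  split=> //; have := integral_pushforward mS mb (mu := nu) (D := setT).
  rewrite preimage_setT => /(_ inu measurableT) h.
  by rewrite -[LHS]h -nuSE eq_int Ib.
exists nu; split.
- exact: (@measurableT _ (g_sigma_algebraType (cylinder A))).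
- by rewrite setCT measure0.
- by move=> a; have [] := key a.
- by move=> a; have [] := key a.
Qed.

End Sufficiency.

Theorem theorem3p9 (R : realType) (A : charAlgType R) (L : {scalar A})
    (L1 : L 1 = 1) :
  ((exists mu : {measure set (g_sigma_algebraType (cylinder A)) -> \bar R},
       representing L setT mu)
   <->
   (exists mu : measure_family A,
      [/\ (forall S, fin_gen S -> radon_representing (L \o inclA S) setT (mu S)),
          exact_system fin_gen mu &
          exists2 muL : measure_family A, corresponding mu muL & thick muL]))
  /\
  ((exists nu : {measure set (borel (X A)) -> \bar R},
       radon_representing L setT nu)
   <->
   (exists mu : measure_family A,
      (forall S, fin_gen S -> radon_representing (L \o inclA S) setT (mu S)) /\
      prokhorov mu)).
Proof.
split; split.
- by move=> [mu /(cylinder_measure_restrictions L1)].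
- move=> [mu [rep _ [muL mu_muL thickL]]].
  exact: (projective_limit_representing mu_muL thickL).
- by move=> [nu /(radon_measure_restrictions L1)].
- move=> [mu [rep pro]]; have [U [UU Ufin Umem]] := @subalgebra_ultrafilter R A.
  exists (limit_measure L1 rep UU Ufin Umem); split.
    apply: representing_of_sqr => //; first exact: limit_measureT.
    exact: limit_measure_sqr.
  exact: limit_measure_radon.
Qed.
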